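(* Let $(\vec X^h(t),\kappa^h_g(t),\vec Y^h_g(t))\in\underline{V}^h\times V^h\times\mathbb{Y}^h$, for $t\in(0,T]$, be a solution to the following semidiscrete scheme $(\mathcal{Q}_h)^\diamond$: given $\vec X^h(0)\in\underline{V}^h_{\partial_0}$, for $t\in(0,T]$ it holds that $\vec X^h_t(t)\in\mathbb{X}^h$ and $$\begin{aligned}&\left(g(\vec X^h)\,\vec X^h_t\,.\,\vec\omega^h,\vec\chi\,.\,\vec\omega^h\,|\vec X^h_\rho|_g\right)^\diamond-\left((\vec Y^h_g)_s\,.\,\vec\nu^h,\vec\chi_s\,.\,\vec\nu^h\,|\vec X^h_\rho|_g\right)^\diamond\\&=-\tfrac12\left((\kappa^h_g)^2-\vec Y^h_g\,.\,\nabla\ln g(\vec X^h),\left[\vec\chi_s\,.\,\vec\tau^h+\tfrac12\,\vec\chi\,.\,\nabla\ln g(\vec X^h)\right]|\vec X^h_\rho|_g\right)^\diamond\\&\quad+\tfrac12\left((D^2\ln g(\vec X^h))\,\vec Y^h_g,\vec\chi\,|\vec X^h_\rho|_g\right)^\diamond\\&\quad+\left(g^{\frac12}(\vec X^h)\,\kappa^h_g\,\vec Y^h_g\,.\,\vec\nu^h+\tfrac12(\vec Y^h_g)_s\,.\,\vec\tau^h,\vec\chi\,.\,(\nabla\ln g(\vec X^h))\,|\vec X^h_\rho|_g\right)^\diamond\\&\quad+\left(g^{\frac12}(\vec X^h)\,\kappa^h_g,\vec\chi_s\,.\,(\vec Y^h_g)^\perp\,|\vec X^h_\rho|_g\right)^\diamond\qquad\forall\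 \vec\chi\in\mathbb{X}^h,\end{aligned}$$ $$\left(\kappa^h_g-g^{\frac12}(\vec X^h)\,\vec Y^h_g\,.\,\vec\nu^h,\chi\,|\vec X^h_\rho|_g\right)^\diamond=0\quad\forall\ \chi\in V^h,$$ $$\begin{aligned}&\left(g^{\frac12}(\vec X^h)\,\kappa^h_g\,\vec\nu^h,\vec\eta\,|\vec X^h_\rho|_g\right)^\diamond+\left(\vec X^h_s,\vec\eta_s\,|\vec X^h_\rho|_g\right)^\diamond+\tfrac12\left(\nabla\ln g(\vec X^h),\vec\eta\,|\vec X^h_\rho|_g\right)^\diamond\\&\quad=\sum_{p\in\partial_CI}[g^{\frac12}(\vec X^h)\,\vec\zeta\,.\,\vec\eta](p)\qquad\forall\ \vec\eta\in\mathbb{Y}^h.\end{aligned}$$ Then the solution satisfies $$\tfrac12\,\frac{\rm d}{{\rm d}t}\left((\kappa^h_g)^2,|\vec X^h_\rho|_g\right)^\diamond+\left(g(\vec X^h)\,(\vec X^h_t\,.\,\vec\omega^h)^2,|\vec X^h_\rho|_g\right)^\diamond=0.$$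
   Context: Metric: $H\subset\mathbb{R}^2$ is a domain and $g:H\to\mathbb{R}_{>0}$ is a smooth positive function; $D^2$ denotes the Hessian. $\vec e_1,\vec e_2$ is the standard basis of $\mathbb{R}^2$; a dot between vectors is the Euclidean inner product; $\cdot^\perp$ is clockwise rotation by $\frac\pi2$. Parameter domain: either $I=\mathbb{R}/\mathbb{Z}$ (closed curve), with $\partial I=\emptyset$, or $I=(0,1)$ (open curve), with $\partial I=\{0,1\}$. $\partial I=\partial_0I\cup\partial_CI\cup\partial_NI$ is a given disjoint partition, and $\vec\zeta:\partial_CI\to\{\vec z\in\mathbb{R}^2:|\vec z|=1\}$ is given (clamped data). The set $\partial_0I$ may be nonempty only if $H=\{\vec z\in\mathbb{R}^2:\vec z\,.\,\vec e_1>0\}$ and either $g(\vec z)=(\vec z\,.\,\vec e_1)^{-2\mu}$ with $\mu\le-1$, or $g(\vec z)=(\vec z\,.\,\vec e_1)^{2(n-1)}e^{-\frac12|\vec z|^2}$ with an integer $n\ge2$; in these cases $g$ and $g^{\frac12}$ are extended $C^1$ up to the $x_2$-axis, where $g=0$, and curve endpoints belonging to $\partial_0I$ lie on the $x_2$-axis. Finite element spaces: for an integer $J\ge3$, $h=J^{-1}$, $q_j=jh$, $I_j=[q_{j-1},q_j]$ (with $q_0$ and $q_J$ identified if $I=\mathbb{R}/\mathbb{Z}$). $V^h=\{\chi\in C(\overline I):\chi|_{I_j}\text{ affine},\ j=1,\dots,J\}$, $\underline{V}^h=[V^h]^2$, $\underline{V}^h_{\partial_0}=\{\vec\eta\in\underline{V}^h:\vec\eta(\rho)\,.\,\vec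 e_1=0\ \forall\rho\in\partial_0I\}$, $\mathbb{X}^h=\{\vec\eta\in\underline{V}^h_{\partial_0}:\vec\eta=\vec0\text{ on }\partial_CI\cup\partial_NI\}$, $\mathbb{Y}^h=\{\vec\eta\in\underline{V}^h_{\partial_0}:\vec\eta=\vec0\text{ on }\partial_NI\}$. Discrete inner products: for piecewise continuous $u,v$ with possible jumps at the nodes, $(u,v)^h=\frac12h\sum_{j=1}^J[(uv)(q_j^-)+(uv)(q_{j-1}^+)]$ with one-sided limits, and $(u,v)^\diamond=I^\diamond(uv)$ with a fixed quadrature rule $$I^\diamond(f)=h\sum_{j=1}^J\sum_{k=1}^Kw_k\,f(\alpha_kq_{j-1}+(1-\alpha_k)q_j),$$ $K\ge2$, $w_k>0$, $\sum_{k=1}^Kw_k=1$, $\alpha_k\in[0,1]$ distinct; values at element endpoints (including products at points of $\partial_0I$ in which $\ln g$ is singular) are understood as one-sided limits from within the element. For vector-valued functions the product is the Euclidean inner product. Subscripts $\rho$, $t$ denote partial derivatives; $\partial_s=|\vec X^h_\rho|^{-1}\partial_\rho$; $|\vec X^h_\rho|_g=g^{\frac12}(\vec X^h)\,|\vec X^h_\rho|$; $\vec\tau^h=\vec X^h_s$, $\vec\nu^h=-(\vec\tau^h)^\perp$. $\vec\omega^h\in\underline{V}^h$ is defined by $(\vec\omega^h,\vec\varphi\,|\vec X^h_\rho|)^h=(\vec\nu^h,\vec\varphi\,|\vec X^h_\rho|)^h$ for all $\vec\varphi\in\underline{V}^h$. A solution is understood to be differentiable in time, with $|\vec X^h_\rho|>0$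 and $\vec X^h(\rho,t)\in H$ for $\rho\in\overline I\setminus\partial_0I$. *)

(* Defs.v *)
From HB Require Import structures.
From mathcomp Require Import all_boot all_order all_algebra.
From mathcomp Require Import all_classical all_reals all_analysis.

Set Implicit Arguments.
Unset Strict Implicit.
Unset Printing Implicit Defensive.

Import Order.TTheory GRing.Theory Num.Theory.
Import numFieldNormedType.Exports.

Local Open Scope classical_set_scope.
Local Open Scope ring_scope.

(* The library norm on 'rV[R]_2 is the sup norm, hence [dot] and [enorm];
   the topology is the same. *)
Section Plane.
Context {R : realType}.
Implicit Types (u v z : 'rV[R]_2) (f : 'rV[R]_2 -> R) (i j : 'I_2).

Definition basis_vec i : 'rV[R]_2 := delta_mx 0 i.
Definition vec_e1 : 'rV[R]_2 := basis_vec 0.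

Definition dot u v : R := \sum_(i < 2) u 0 i * v 0 i.
Definition enorm u : R := Num.sqrt (dot u u).

(* clockwise rotation by pi/2: (a, b) |-> (b, -a) *)
Definition perp u : 'rV[R]_2 := \row_i (if i == 0 then u 0 1 else - u 0 0).

Definition partial i f : 'rV[R]_2 -> R := fun z => 'D_(basis_vec i) f z.
Definition grad f z : 'rV[R]_2 := \row_i partial i f z.
Definition hess f z : 'M[R]_2 := \matrix_(i, j) partial i (partial j f) z.

(* vectors are rows, so the matrix-vector product A v is (A v^T)^T *)
Definition mulmxv (A : 'M[R]_2) v : 'rV[R]_2 := (A *m v^T)^T.

(* C^oo on an open set A: all iterated partial derivatives are
   (Frechet-)differentiable on A *)
Definition smooth_on (A : set 'rV[R]_2) f : Prop :=
  forall (s : seq 'I_2) z, A z -> differentiable (foldr partial f s) z.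

Definition domain (A : set 'rV[R]_2) : Prop :=
  [/\ A !=set0, open A & connected A].

End Plane.

Notation "u *d v" := (dot u v) (at level 40, left associativity) : ring_scope.

(* Derivative relative to ]0, T]: two-sided for t < T, from the left at T. *)
Section TimeDerivative.
Context {R : realType} {V : normedModType R}.

Definition time_quot (f : R -> V) (t s : R) : V := (s - t)^-1 *: (f s - f t).

Definition time_derivable (T : R) (f : R -> V) (t : R) : Prop :=
  cvg (time_quot f t s @[s --> within `]0, T] t^']).

Definition time_derive (T : R) (f : R -> V) (t : R) : V :=
  lim (time_quot f t s @[s --> within `]0, T] t^']).

End TimeDerivative.

(* ClosedCurve is I = R/Z, with functions on I represented on [0, 1];
   OpenCurve is I = (0, 1). Values outside [0, 1] play no role. *)
Inductive param_domain := ClosedCurve | OpenCurve.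

Section Setting.
Context {R : realType}.
Local Notation vec := 'rV[R]_2.

Definition bdry (I : param_domain) : set R :=
  if I is OpenCurve then [set 0; 1] else set0.

Definition boundary_partition (I : param_domain) (d0 dC dN : set R) : Prop :=
  [/\ d0 `|` dC `|` dN = bdry I,
      d0 `&` dC = set0, d0 `&` dN = set0 & dC `&` dN = set0].

Definition metric (H : set vec) (g : vec -> R) : Prop :=
  [/\ domain H, smooth_on H g & forall z, H z -> 0 < g z].

Definition axis_metric (H : set vec) (g : vec -> R) : Prop :=
  [/\ H = [set z | 0 < z *d vec_e1],
      (exists2 mu : R, mu <= -1 &
         forall z, H z -> g z = (z *d vec_e1) `^ (- 2 * mu))
      \/ (exists2 n : nat, (2 <= n)%N &
         forall z, H z ->
           g z = (z *d vec_e1) ^+ (2 * (n - 1)) * expR (- 2^-1 * enorm z ^+ 2))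
    & forall z, z *d vec_e1 = 0 -> g z = 0].

Section FiniteElements.
Variables (I : param_domain) (d0 dC dN : set R) (J : nat).

Definition node (j : nat) : R := j%:R * J%:R^-1.

Definition Vh (chi : R -> R) : Prop :=
  [/\ {within `[0, 1], continuous chi},
      forall j, (j < J)%N -> exists a b : R,
        forall r, r \in `[node j, node j.+1] -> chi r = a * r + b
    & if I is ClosedCurve then chi 0 = chi 1 else True].

Definition Vh2 (eta : R -> vec) : Prop := forall i, Vh (fun r => eta r 0 i).

Definition Vh2_0 (eta : R -> vec) : Prop :=
  Vh2 eta /\ forall p, d0 p -> eta p *d vec_e1 = 0.

Definition Xh (eta : R -> vec) : Prop :=
  Vh2_0 eta /\ forall p, (dC `|` dN) p -> eta p = 0.

Definition Yh (eta : R -> vec) : Prop :=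
  Vh2_0 eta /\ forall p, dN p -> eta p = 0.

Definition massh (f : R -> R) : R :=
  2^-1 * J%:R^-1 *
  \sum_(j < J) (lim (f r @[r --> (node j.+1)^'-])
              + lim (f r @[r --> (node j)^'+])).

Definition iph2 (u v : R -> vec) : R := massh (fun r => u r *d v r).

Section Quadrature.
Variables (K : nat) (w alpha : 'I_K -> R).

Definition quadrature_rule : Prop :=
  [/\ (2 <= K)%N, forall k, 0 < w k, \sum_(k < K) w k = 1,
      forall k, 0 <= alpha k <= 1 & injective alpha].

(* Value at a * node j + (1 - a) * node j.+1. At element endpoints it is the
   limit of the whole product f, whose factors may be singular there (ln g on
   the x_2-axis). *)
Definition elem_value (f : R -> R) (j : nat) (a : R) : R :=
  if a == 1 then lim (f r @[r --> (node j)^'+])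
  else if a == 0 then lim (f r @[r --> (node j.+1)^'-])
  else f (a * node j + (1 - a) * node j.+1).

Definition quad (f : R -> R) : R :=
  J%:R^-1 * \sum_(j < J) \sum_(k < K) w k * elem_value f j (alpha k).

Definition ipq (u v : R -> R) : R := quad (fun r => u r * v r).
Definition ipq2 (u v : R -> vec) : R := quad (fun r => u r *d v r).

End Quadrature.
End FiniteElements.

Section Curve.
Variables (g : vec -> R) (x : R -> vec).

Definition speed (r : R) : R := enorm (derive1 x r).
Definition gspeed (r : R) : R := Num.sqrt (g (x r)) * speed r.
Definition ds (eta : R -> vec) (r : R) : vec := (speed r)^-1 *: derive1 eta r.
Definition tau : R -> vec := ds x.
Definition nu (r : R) : vec := - perp (tau r).

Definition is_vertex_normal (I : param_domain) (J : nat) (om : R -> vec) : Prop :=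
  Vh2 I J om /\
  forall phi, Vh2 I J phi ->
    iph2 J om (fun r => speed r *: phi r) = iph2 J nu (fun r => speed r *: phi r).

End Curve.

Section Scheme.
Variables (H : set vec) (g : vec -> R).
Variables (I : param_domain) (d0 dC dN : set R) (zeta : R -> vec).
Variables (J K : nat) (w alpha : 'I_K -> R).

Local Notation "( u , v )_q" := (ipq J w alpha u v) (format "( u ,  v )_q").
Local Notation "( u , v )_q2" := (ipq2 J w alpha u v) (format "( u ,  v )_q2").
Local Notation lng := (fun z => ln (g z)).
Local Notation sqg := (fun z => Num.sqrt (g z)).

(* The three equations at a fixed time, for the curve x with velocity v,
   curvature kap, multiplier y and vertex normal om *)
Section Equations.
Variables (x v : R -> vec) (kap : R -> R) (y om : R -> vec).
Let xg := gspeed g x.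
Let nux := nu x.
Let taux := tau x.
Let glng (r : R) : vec := grad lng (x r).

Definition eq_motion : Prop := forall chi, Xh I d0 dC dN J chi ->
  (fun r => g (x r) * (v r *d om r), fun r => (chi r *d om r) * xg r)_q
  - (fun r => ds x y r *d nux r, fun r => (ds x chi r *d nux r) * xg r)_q
  = - 2^-1 * (fun r => kap r ^+ 2 - y r *d glng r,
              fun r => (ds x chi r *d taux r + 2^-1 * (chi r *d glng r)) * xg r)_q
  + 2^-1 * (fun r => mulmxv (hess lng (x r)) (y r), fun r => xg r *: chi r)_q2
  + (fun r => sqg (x r) * kap r * (y r *d nux r) + 2^-1 * (ds x y r *d taux r),
     fun r => (chi r *d glng r) * xg r)_q
  + (fun r => sqg (x r) * kap r, fun r => (ds x chi r *d perp (y r)) * xg r)_q.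

Definition eq_curvature : Prop := forall chi, Vh I J chi ->
  (fun r => kap r - sqg (x r) * (y r *d nux r), fun r => chi r * xg r)_q = 0.

Definition eq_side : Prop := forall eta, Yh I d0 dN J eta ->
  (fun r => (sqg (x r) * kap r) *: nux r, fun r => xg r *: eta r)_q2
  + (fun r => ds x x r, fun r => xg r *: ds x eta r)_q2
  + 2^-1 * (glng, fun r => xg r *: eta r)_q2
  = \sum_(p \in dC) sqg (x p) * (zeta p *d eta p).

End Equations.

Definition velocity (T : R) (X : R -> R -> vec) (t r : R) : vec :=
  time_derive T (fun s => X s r) t.

Record is_solution (T : R) (X : R -> R -> vec) (kap : R -> R -> R)
    (Y om : R -> R -> vec) : Prop := {
  sol_init : Vh2_0 I d0 J (X 0) ;
  sol_init_attained : forall r, r \in `[0, 1] -> X s r @[s --> 0^'+] --> X 0 r ;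
  sol_spaces : forall t, t \in `]0, T] ->
    [/\ Vh2 I J (X t), Vh I J (kap t) & Yh I d0 dN J (Y t)] ;
  sol_axis : forall t p, t \in `]0, T] -> d0 p -> X t p *d vec_e1 = 0 ;
  sol_in_H : forall t r, t \in `]0, T] -> r \in `[0, 1] -> ~ d0 r -> H (X t r) ;
  sol_regular : forall t j r, t \in `]0, T] -> (j < J)%N ->
    r \in `]node J j, node J j.+1[ -> 0 < speed (X t) r ;
  sol_derivable : forall t r, t \in `]0, T] -> r \in `[0, 1] ->
    [/\ time_derivable T (fun s => X s r) t,
        time_derivable T (fun s => kap s r) t
      & time_derivable T (fun s => Y s r) t] ;
  sol_vertex_normal : forall t, t \in `]0, T] ->
    is_vertex_normal (X t) I J (om t) ;
  sol_velocity : forall t, t \in `]0, T] ->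
    Xh I d0 dC dN J (velocity T X t) ;
  sol_motion : forall t, t \in `]0, T] ->
    eq_motion (X t) (velocity T X t) (kap t) (Y t) (om t) ;
  sol_curvature : forall t, t \in `]0, T] -> eq_curvature (X t) (kap t) (Y t) ;
  sol_side : forall t, t \in `]0, T] -> eq_side (X t) (kap t)
}.

End Scheme.
End Setting.

(* Main.v *)
Require Import Defs.
From HB Require Import structures.
From mathcomp Require Import all_boot all_order all_algebra.
From mathcomp Require Import all_classical all_reals all_analysis.
From mathcomp Require Import ring lra.
Import Order.TTheory GRing.Theory Num.Theory.
Import numFieldNormedType.Exports.
Local Open Scope classical_set_scope.
Local Open Scope ring_scope.
Set Implicit Arguments.
Unset Strict Implicit.
Unset Printing Implicit Defensive.

(** Test the curvature equation with kappa_t, the equation of motion with X_t,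
    and the time derivative of the side equation with Y. Adding the three
    results gives the energy law: the inner products on the three left-hand
    sides are evaluated by one and the same quadrature rule, and the
    cancellation takes place in the integrands, so it survives at each
    quadrature point without any integration by parts ([energy_identity]).
    On each element the parametric derivatives of X, X_t and Y are constant,
    and the integrands are polynomials in these derivatives, 1 / |X_rho|,
    g^(1/2), Y, kappa, kappa_t and the products of the derivatives of ln g with
    X_t and Y. The vertex normal enters through a term that appears unchanged in
    the energy law.

    In the time derivative of the side equation, the test function Y(t) is kept
    fixed in time; the right-hand side has derivative zero because clamped
    endpoints do not move ([tderiv_clamped]). That kappa_t is an admissible test
    function follows from the uniqueness of time derivatives ([Vh_tderiv]).

    An endpoint on the x_2-axis is harmless although ln g is singular there.
    The first components of X and of an admissible test function y both vanish
    at the endpoint and are affine on the element, so their quotient is constant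
    on it; as grad (ln g) is c / z_1 in the first direction up to a continuous
    remainder, y . grad (ln g) and (D^2 ln g) y . v have limits at the endpoint
    ([cvg_grad_dot], [cvg_hess_dot]). Each integrand has a factor g^(1/2)(X),
    which tends to zero, so these endpoints contribute nothing at any time.

    Limits of products at element endpoints and plain values at interior points
    are both limits along one filter ([elem_filter]), and the one-sided time
    derivative at T is an ordinary derivative of an extension beyond T
    ([has_tderiv]); this makes the usual calculus rules available. *)

(** * Differentiation in time *)

Section TimeCalculus.
Context {R : realType} (T : R).

(** The extension [F] lets the calculus of two-sided derivatives act at [t = T],
    where only a derivative from the left is available. *)
Definition has_tderiv {V : normedModType R} (f : R -> V) (t : R) (l : V) :=
  exists2 F : R -> V,
    (forall s, s \in `]0, T] -> F s = f s) & is_derive t 1 F l.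

Lemma within_itv_proper (t : R) : t \in `]0, T] ->
  ProperFilter (within (fun s => s \in `]0, T]) t^').
Proof.
rewrite in_itv/= => /andP[t0 tT].
refine (@Build_ProperFilter_ex _ _ _ (within_filter _ _)) => P P0.
suff h : \forall s \near t^'-, P s.
  exact: (@filter_ex _ _ (at_left_proper_filter t) _ h).
have P1 : \forall s \near t^'-, s \in `]0, T] -> P s.
  have P2 : \forall s \near t, s != t -> s \in `]0, T] -> P s by exact: P0.
  have P3 : \forall s \near t, s < t -> s \in `]0, T] -> P s.
    by near=> s => st; apply: (near P2 s) => //; rewrite lt_eqF.
  exact: P3.
near=> s; apply: (near P1 s) => //.
by rewrite in_itv/= (le_trans _ tT)// andbT; near: s; exact: nbhs_left_gt.
Unshelve. all: by end_near. Qed.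

Lemma is_derive_quotP {V : normedModType R} (F : R -> V) (t : R) (l : V) :
  is_derive t 1 F l <-> time_quot F t s @[s --> t^'] --> l.
Proof.
have E : ((fun h : R => h^-1 *: ((F \o shift t) (h *: 1) - F t)) @ 0^') =
         (time_quot F t s @[s --> t^']).
  have -> : (fun h : R => h^-1 *: ((F \o shift t) (h *: 1) - F t)) =
            time_quot F t \o (fun h => h + t).
    by apply/funext => h; rewrite /time_quot /= addrK [h *: 1]mulr1.
  apply/seteqP; split => P; rewrite /nbhs/= /nbhs /= /dnbhs /within /=.
    move=> /nbhs_ballP[e e0 /= He]; apply/nbhs_ballP; exists e => //= s.
    rewrite /ball /= => tse st.
    have := He (s - t); rewrite /ball /= sub0r normrN distrC subr_eq0.
    by rewrite subrK; apply.
  move=> /nbhs_ballP[e e0 /= He]; apply/nbhs_ballP; exists e => //= h.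
  rewrite /ball /= sub0r normrN => tse st.
  apply: He; first by rewrite /ball /= opprD addrCA subrr addr0 normrN.
  by rewrite -subr_eq0 addrK.
split.
  case; rewrite /derivable /derive E => Fd Fl.
  by rewrite -Fl; exact: Fd.
move=> Fl; split; rewrite /derivable /derive E; last exact: cvg_lim.
by apply/cvg_ex; exists l.
Qed.

(** From right to left, the extension continues [f] outside ]0, T] by its
    tangent line at [t]. *)
Lemma has_tderivP {V : normedModType R} (f : R -> V) (t : R) (l : V) :
  t \in `]0, T] ->
  has_tderiv f t l <->
  time_quot f t s @[s --> within (fun s => s \in `]0, T]) t^'] --> l.
Proof.
move=> tT; split.
  case=> F Ff /is_derive_quotP Fl.
  apply: (@cvg_trans _ 
    (time_quot F t s @[s --> within (fun s => s \in `]0, T]) t^'])).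
    apply: near_eq_cvg; near=> s.
    by rewrite /time_quot !Ff//; near: s; exact: withinT.
  apply: cvg_trans _ Fl; apply: cvg_app; exact: cvg_within.
move=> fl.
exists (fun s => if s \in `]0, T] then f s else f t + (s - t) *: l).
  by move=> s ->.
apply/is_derive_quotP.
have {}fl A : nbhs l A ->
    \forall s \near t^', s \in `]0, T] -> A (time_quot f t s).
  by move=> /fl.
move=> A /[dup] lA /fl; rewrite /= => Af.
rewrite /nbhs /=; near=> s.
have [sT|sT] := boolP (s \in `]0, T]).
  by rewrite /time_quot /= sT tT; move: (sT); near: s.
rewrite /time_quot /= (negbTE sT) tT addrAC subrr add0r scalerA mulVf ?scale1r.
  exact: nbhs_singleton.
by rewrite subr_eq0; near: s; exact: nbhs_dnbhs_neq.
Unshelve. all: by end_near. Qed.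

Lemma time_derivable_has {V : normedModType R} (f : R -> V) (t : R) :
  t \in `]0, T] -> time_derivable T f t -> has_tderiv f t (time_derive T f t).
Proof. by move=> tT fd; apply/has_tderivP. Qed.

Lemma has_tderiv_derivable {V : normedModType R} (f : R -> V) (t : R) l :
  t \in `]0, T] -> has_tderiv f t l ->
  time_derivable T f t /\ time_derive T f t = l.
Proof.
move=> tT /(has_tderivP _ _ tT) fl; have := within_itv_proper tT => PF.
split; first by apply/cvg_ex; exists l.
exact: (@cvg_lim _ (@norm_hausdorff _ V) _ _ PF _ _ fl).
Qed.

Lemma has_tderiv_unique {V : normedModType R} (f : R -> V) (t : R) l l' :
  t \in `]0, T] -> has_tderiv f t l -> has_tderiv f t l' -> l = l'.
Proof.
by move=> tT /(has_tderiv_derivable tT)[_ <-] /(has_tderiv_derivable tT)[_ <-].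
Qed.

Lemma eq_has_tderiv {V : normedModType R} (f f' : R -> V) (t : R) l :
  (forall s, s \in `]0, T] -> f s = f' s) ->
  has_tderiv f t l -> has_tderiv f' t l.
Proof. by move=> ff' [F Ff Fl]; exists F => // s sT; rewrite Ff// ff'. Qed.

Lemma has_tderiv_cst {V : normedModType R} (c : V) (t : R) :
  has_tderiv (fun=> c) t 0.
Proof. by exists (cst c) => //; exact: is_derive_cst. Qed.

Lemma has_tderivD {V : normedModType R} (f f' : R -> V) (t : R) l l' :
  has_tderiv f t l -> has_tderiv f' t l' ->
  has_tderiv (fun s => f s + f' s) t (l + l').
Proof.
move=> [F Ff Fl] [G Gf Gl]; exists (F + G); last exact: is_deriveD.
by move=> s sT; rewrite -Ff// -Gf.
Qed.

Lemma has_tderivM (f f' : R -> R) (t : R) l l' :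
  t \in `]0, T] -> has_tderiv f t l -> has_tderiv f' t l' ->
  has_tderiv (fun s => f s * f' s) t (l * f' t + f t * l').
Proof.
move=> tT [F Ff Fl] [G Gf Gl]; exists (F * G).
  by move=> s sT; rewrite -Ff// -Gf.
apply: is_derive_eq (is_deriveM _ _) _.
by rewrite Ff// Gf// addrC; congr (_ + _); rewrite [_ *: _]mulrC.
Qed.

Lemma has_tderiv_comp {V W : normedModType R} (phi : V -> W) (f : R -> V) (t : R) l :
  t \in `]0, T] -> has_tderiv f t l -> differentiable phi (f t) ->
  has_tderiv (fun s => phi (f s)) t ('D_l phi (f t)).
Proof.
move=> tT [F Ff [Fd Fl]]; rewrite -Ff// => dphi.
exists (phi \o F); first by move=> s sT /=; rewrite Ff.
have dF : differentiable F t by exact/derivable1_diffP.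
have dc : differentiable (phi \o F) t by exact: differentiable_comp.
split; first exact/derivable1_diffP.
by rewrite -Fl [LHS]deriveE// diff_comp//= (@deriveE _ _ _ F t 1 dF) [RHS]deriveE.
Qed.

Lemma has_tderiv_sum (n : nat) (f : 'I_n -> R -> R) (t : R) (l : 'I_n -> R) :
  (forall i, has_tderiv (f i) t (l i)) ->
  has_tderiv (fun s => \sum_i f i s) t (\sum_i l i).
Proof.
elim: n f l => [f l _|n IH f l fl].
  rewrite big_ord0; under eq_fun do rewrite big_ord0; exact: has_tderiv_cst.
rewrite big_ord_recl; under eq_fun do rewrite big_ord_recl.
by apply: has_tderivD => //; exact: IH.
Qed.

Lemma has_tderiv_comp1 (phi : R -> R) (f : R -> R) (t l d : R) :
  t \in `]0, T] -> has_tderiv f t l -> is_derive (f t) 1 phi d ->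
  has_tderiv (fun s => phi (f s)) t (l * d).
Proof.
move=> tT fl [phid <-].
have dphi : differentiable phi (f t) by exact/derivable1_diffP.
have := has_tderiv_comp tT fl dphi.
by rewrite !deriveE// -{1}[l]mulr1 -[l * 1]/(l *: (1 : R)) linearZ.
Qed.

End TimeCalculus.

(** * Quadrature points as filters *)

Section Element.
Context {R : realType} (I : param_domain) (J j : nat).
Hypothesis jJ : (j < J)%N.
Local Notation vec := 'rV[R]_2.
Implicit Types (chi : R -> R) (eta : R -> vec) (r p a : R).

Definition slope {V : normedModType R} (f : R -> V) : V :=
  J%:R *: (f (node J j.+1) - f (node J j)).

Lemma invJ_gt0 : 0 < J%:R^-1 :> R.
Proof. by rewrite invr_gt0 ltr0n (leq_ltn_trans _ jJ). Qed.

Lemma nodeS : node J j.+1 = node J j + J%:R^-1 :> R.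
Proof. by rewrite /node -addn1 natrD mulrDl mul1r. Qed.

Lemma node_ge0 : 0 <= node J j :> R.
Proof. by rewrite mulr_ge0// ltW// invJ_gt0. Qed.

Lemma node_le1 : node J j.+1 <= 1 :> R.
Proof.
by rewrite /node ler_pdivrMr ?mul1r ?ler_nat// ltr0n (leq_ltn_trans _ jJ).
Qed.

Lemma node_lt : node J j < node J j.+1 :> R.
Proof. by rewrite nodeS ltrDl invJ_gt0. Qed.

Lemma Vh_affine chi p r : Vh I J chi ->
  p \in `[node J j, node J j.+1] -> r \in `[node J j, node J j.+1] ->
  chi r = chi p + (r - p) * slope chi.
Proof.
move=> [_ /(_ j jJ)[a [b ab]] _] pI rI.
have l : (node J j : R) \in `[node J j, node J j.+1].
  by rewrite in_itv/= lexx ltW// node_lt.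
have u : (node J j.+1 : R) \in `[node J j, node J j.+1].
  by rewrite in_itv/= lexx ltW// node_lt.
rewrite /slope !ab// nodeS.
have J0 : J%:R != 0 :> R by rewrite -invr_eq0 gt_eqF// invJ_gt0.
by rewrite /GRing.scale/=; field.
Qed.

Lemma Vh2_affine eta p r : Vh2 I J eta ->
  p \in `[node J j, node J j.+1] -> r \in `[node J j, node J j.+1] ->
  eta r = eta p + (r - p) *: slope eta.
Proof.
move=> etaV pI rI; apply/rowP => i.
by rewrite (Vh_affine (etaV i) pI rI) /slope !mxE.
Qed.

Lemma Vh2_derive1 eta r : Vh2 I J eta ->
  r \in `]node J j, node J j.+1[ -> derive1 eta r = slope eta.
Proof.
move=> etaV rI; rewrite derive1E.
have rI' : r \in `[node J j, node J j.+1] by exact: subset_itv_oo_cc rI.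
suff : is_derive r 1 eta (slope eta) by case.
apply/is_derive_quotP; apply: cvg_near_cst; near=> q.
have qr : q - r != 0 by rewrite subr_eq0; near: q; exact: nbhs_dnbhs_neq.
rewrite /time_quot (@Vh2_affine eta r q)// 1?addrAC ?subrr ?add0r.
  by rewrite scalerA mulVf ?scale1r.
by apply: subset_itv_oo_cc; near: q; apply: nbhs_dnbhs; exact: near_in_itvoo.
Unshelve. all: by end_near. Qed.

Definition quad_point a : R := a * node J j + (1 - a) * node J j.+1.

(** The principal filter at interior points turns each of the three cases of
    [elem_value] into a limit, so that they need not be told apart below. *)
Definition elem_filter a : set_system R :=
  if a == 1 then (node J j)^'+
  else if a == 0 then (node J j.+1)^'-
  else globally [set quad_point a].

Global Instance elem_filter_proper a : ProperFilter (elem_filter a).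
Proof.
rewrite /elem_filter; case: ifP => _; first exact: at_right_proper_filter.
case: ifP => _; first exact: at_left_proper_filter.
exact: (@globally_properfilter _ _ (quad_point a)).
Qed.

Lemma elem_valueE (f : R -> R) a :
  elem_value J f j a = lim (f r @[r --> elem_filter a]).
Proof.
rewrite /elem_value /elem_filter; case: ifP => // _; case: ifP => // _.
apply/esym/cvg_lim => //; first exact: globally_properfilter.
by move=> A /nbhs_singleton fA x /= ->.
Qed.

Variable a : R.
Hypothesis a01 : 0 <= a <= 1.
Let F := elem_filter a.

Lemma quad_point_in : quad_point a \in `[node J j, node J j.+1].
Proof.
case/andP: a01 => a0 a1; have := node_lt; rewrite in_itv/= /quad_point => lt.
apply/andP; split.
  rewrite -subr_ge0 (_ : _ - _ = (1 - a) * (node J j.+1 - node J j)); last ring.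
  by rewrite mulr_ge0 ?subr_ge0// ltW.
rewrite -subr_ge0 (_ : _ - _ = a * (node J j.+1 - node J j)); last ring.
by rewrite mulr_ge0 ?subr_ge0// ltW.
Qed.

Lemma near_elem : \forall r \near F, r \in `]node J j, node J j.+1[.
Proof.
rewrite /F /elem_filter; case: ifPn => a1.
  by near=> r; rewrite in_itv/=; apply/andP; split => //; near: r;
    exact: nbhs_right_lt node_lt.
case: ifPn => a0.
  by near=> r; rewrite in_itv/=; apply/andP; split => //; near: r;
    exact: nbhs_left_gt node_lt.
move=> r /= ->; have := node_lt; case/andP: a01; rewrite !le_eqVlt (negbTE a1).
rewrite eq_sym (negbTE a0)/= => {}a0 {}a1 lt.
rewrite in_itv/= /quad_point; apply/andP; split.
  rewrite -subr_gt0 (_ : _ - _ = (1 - a) * (node J j.+1 - node J j)); last ring.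
  by rewrite mulr_gt0 ?subr_gt0.
rewrite -subr_gt0 (_ : _ - _ = a * (node J j.+1 - node J j)); last ring.
by rewrite mulr_gt0 ?subr_gt0.
Unshelve. all: by end_near. Qed.

Lemma elem_cvg_id : r @[r --> F] --> quad_point a.
Proof.
rewrite /F /elem_filter /quad_point; case: ifPn => [/eqP ->|a1].
  by rewrite subrr mul0r addr0 mul1r; exact: cvg_at_right_filter cvg_id.
case: ifPn => [/eqP ->|a0].
  by rewrite subr0 mul0r add0r mul1r; exact: cvg_at_left_filter cvg_id.
by move=> A /nbhs_singleton fA x /= ->.
Qed.

Lemma elem_value_cvg (f : R -> R) l :
  f r @[r --> F] --> l -> elem_value J f j a = l.
Proof. by move=> fl; rewrite elem_valueE; apply: cvg_lim. Qed.

Lemma elem_cvg_near {V : normedModType R} (f f' : R -> V) (l : V) :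
  (forall r, r \in `]node J j, node J j.+1[ -> f r = f' r) ->
  f' r @[r --> F] --> l -> f r @[r --> F] --> l.
Proof.
move=> ff' fl; apply: cvg_trans fl; apply: near_eq_cvg.
by near=> r; apply/esym/ff'; near: r; exact: near_elem.
Unshelve. all: by end_near. Qed.

Lemma Vh_cvg chi : Vh I J chi -> chi r @[r --> F] --> chi (quad_point a).
Proof.
move=> chiV.
apply: (@elem_cvg_near _ _
  (fun r => chi (quad_point a) + (r - quad_point a) * slope chi)).
  move=> r rI; apply: Vh_affine => //; first exact: quad_point_in.
  exact: subset_itv_oo_cc rI.
rewrite -[X in _ --> X]addr0 -(mul0r (slope chi)) -(subrr (quad_point a)).
apply: cvgD; first exact: cvg_cst.
by apply: cvgMl; apply: cvgB; [exact: elem_cvg_id|exact: cvg_cst].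
Qed.

Lemma Vh2_cvg eta : Vh2 I J eta -> eta r @[r --> F] --> eta (quad_point a).
Proof.
move=> etaV.
apply: (@elem_cvg_near _ _
  (fun r => eta (quad_point a) + (r - quad_point a) *: slope eta)).
  move=> r rI; apply: Vh2_affine => //; first exact: quad_point_in.
  exact: subset_itv_oo_cc rI.
rewrite -[X in _ --> X]addr0 -(scale0r (slope eta)) -(subrr (quad_point a)).
apply: cvgD; first exact: cvg_cst.
by apply: cvgZr_tmp; apply: cvgB; [exact: elem_cvg_id|exact: cvg_cst].
Qed.

End Element.

(** * Derivatives of ln g *)

Section LogMetric.
Context {R : realType}.
Local Notation vec := 'rV[R]_2.

Lemma near_cvg {S : Type} {U : nbhsType} (F : set_system S) {FF : Filter F}
    (f f' : S -> U) (l : U) :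
  (\forall x \near F, f' x = f x) -> f x @[x --> F] --> l ->
  f' x @[x --> F] --> l.
Proof.
move=> ff' fl; apply: cvg_trans fl; apply: near_eq_cvg.
by apply: filterS ff'.
Qed.

Lemma near_eq_differentiable {V W : normedModType R} (f f' : V -> W) (x : V) :
  (\forall y \near x, f y = f' y) -> differentiable f x -> differentiable f' x.
Proof.
move=> ff' /diffP[dc dE]; apply/diffP => /=.
apply: (@getPex _ (fun (df : {linear V -> W}) => continuous df /\
  forall y, f' y = f' (lim (nbhs x)) + df (y - lim (nbhs x))
                  +o_(y \near x) (y - lim (nbhs x)))).
exists ('d f x); split => //.
suff : f' = (fun y => f' (lim (nbhs x)) + 'd f x (y - lim (nbhs x)))
            +o_x (fun y => y - lim (nbhs x)) by rewrite funeqE.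
apply/eqaddoP => e e0.
have /eqaddoP/(_ e e0) dE' :
    f = (fun y => f (lim (nbhs x)) + 'd f x (y - lim (nbhs x)))
        +o_x (fun y => y - lim (nbhs x)).
  by apply/funext => z; rewrite [LHS]dE.
near=> z.
rewrite -[_ z]/(f' z - (f' (lim (nbhs x)) + 'd f x (z - lim (nbhs x)))).
have <- : f z = f' z by near: z.
have <- : f (lim (nbhs x)) = f' (lim (nbhs x)).
  by rewrite lim_id//; exact: nbhs_singleton ff'.
by near: z.
Unshelve. all: by end_near. Qed.

Lemma dotE (u v : vec) : u *d v = u 0 0 * v 0 0 + u 0 1 * v 0 1.
Proof.
rewrite /dot big_ord_recl big_ord1; congr (_ * _ + _ * _);
  by congr (_ 0 _); apply/val_inj.
Qed.

Lemma vec_basis (v : vec) : v = v 0 0 *: basis_vec 0 + v 0 1 *: basis_vec 1.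
Proof.
apply/rowP => i; rewrite !mxE !eqxx/=.
have [->|->] : i = 0 \/ i = 1.
  by case: i => [[|[|//]]] i2; [left|right]; apply/val_inj.
- by rewrite eqxx mulr1 mulr0 addr0.
- by rewrite eqxx mulr1 mulr0 add0r.
Qed.

Lemma derive_grad (f : vec -> R) (z v : vec) :
  differentiable f z -> 'D_v f z = grad f z *d v.
Proof.
move=> df; rewrite deriveE// {1}(vec_basis v) linearD !linearZ/=.
by rewrite -!deriveE// dotE !mxE [_ *: _]mulrC; congr (_ + _); rewrite [_ *: _]mulrC.
Qed.

Variables (H : set vec) (g : vec -> R).
Hypothesis hg : metric H g.
Local Notation lng := (fun z => ln (g z)).
Implicit Types (z : vec) (i j : 'I_2).

Lemma near_H z : H z -> \forall y \near z, H y.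
Proof. by case: hg => [[_ oH _] _ _] Hz; apply: open_nbhs_nbhs. Qed.

Lemma g_gt0 z : H z -> 0 < g z.
Proof. by case: hg => _ _; exact. Qed.

Lemma g_differentiable z : H z -> differentiable g z.
Proof. by case: hg => _ sm _ Hz; exact: (sm [::]). Qed.

Lemma partial_differentiable i z : H z -> differentiable (partial i g) z.
Proof. by case: hg => _ sm _ Hz; exact: (sm [:: i]). Qed.

Lemma partial2_differentiable i j z :
  H z -> differentiable (partial i (partial j g)) z.
Proof. by case: hg => _ sm _ Hz; exact: (sm [:: i; j]). Qed.

Lemma ln_differentiable (x : R) : 0 < x -> differentiable (@ln R) x.
Proof. by move=> x0; apply/derivable1_diffP; have [] := is_derive1_ln x0. Qed.

Lemma is_derive_comp1 {V : normedModType R} (phi : R -> R) (f : V -> R)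
    (x v : V) (df d : R) :
  differentiable f x -> is_derive x v f df -> is_derive (f x) 1 phi d ->
  is_derive x v (fun y => phi (f y)) (df * d).
Proof.
move=> fd [_ <-] [phid <-].
have phid' : differentiable phi (f x) by exact/derivable1_diffP.
have cd : differentiable (phi \o f) x by exact: differentiable_comp.
split; first exact: diff_derivable.
rewrite [LHS](_ : _ = 'd (phi \o f) x v); last by rewrite -deriveE.
rewrite diff_comp//= -(@deriveE _ _ _ f)//; set e := 'D_v f x.
have -> : e = e *: (1 : R) by rewrite /GRing.scale/= mulr1.
by rewrite [LHS]linearZ/= -deriveE// /GRing.scale/= mulr1.
Qed.

Lemma lng_differentiable z : H z -> differentiable lng z.
Proof.
move=> Hz; apply: (@differentiable_comp _ _ _ _ g (@ln R)).
  exact: g_differentiable.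
by apply: ln_differentiable; exact: g_gt0.
Qed.

Lemma partial_lng i z : H z -> partial i lng z = (g z)^-1 * partial i g z.
Proof.
move=> Hz; rewrite /partial.
have gi : is_derive z (basis_vec i) g ('D_(basis_vec i) g z).
  by split => //; apply: diff_derivable; exact: g_differentiable.
have [_ ->] := is_derive_comp1 (g_differentiable Hz) gi (is_derive1_ln (g_gt0 Hz)).
by rewrite mulrC.
Qed.

Lemma grad_lng z : H z -> grad g z = g z *: grad lng z.
Proof.
move=> Hz; apply/rowP => i; rewrite !mxE partial_lng// mulrA mulfV ?mul1r//.
by rewrite gt_eqF// g_gt0.
Qed.

Lemma partial_lng_differentiable i z : H z -> differentiable (partial i lng) z.
Proof.
move=> Hz; apply: (@near_eq_differentiable _ _ (fun z => (g z)^-1 * partial i g z)).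
  by apply: filterS (near_H Hz) => y Hy; rewrite partial_lng.
apply: differentiableM; last exact: partial_differentiable.
by apply: differentiableV; [exact: g_differentiable|rewrite gt_eqF// g_gt0].
Qed.

Lemma partial2_lng i j z : H z -> partial i (partial j lng) z =
  (g z)^-1 * partial i (partial j g) z - (g z)^-2 * partial i g z * partial j g z.
Proof.
move=> Hz; rewrite {1}/partial.
rewrite -(@near_eq_derive _ _ _ (fun z => (g z)^-1 * partial j g z)); last first.
  by apply: filterS (near_H Hz) => y Hy; rewrite partial_lng.
have gd : derivable g z (basis_vec i) by apply: diff_derivable; exact: g_differentiable.
have g0 : g z != 0 by rewrite gt_eqF// g_gt0.
rewrite [LHS]deriveM; last 2 first.
  by apply: diff_derivable; apply: differentiableV => //; exact: g_differentiable.
  by apply: diff_derivable; exact: partial_differentiable.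
rewrite deriveV// -/(partial i g z) -/(partial i (partial j g) z).
rewrite /GRing.scale/=; ring.
Qed.

(** Obtained from the explicit formula, whose right-hand side involves
    derivatives of [g] only. *)
Lemma hess_lng_continuous i j z : H z ->
  partial i (partial j lng) y @[y --> z] --> partial i (partial j lng) z.
Proof.
move=> Hz; rewrite partial2_lng//.
apply: (@near_cvg _ _ (nbhs z) _ (fun z => (g z)^-1 * partial i (partial j g) z
                                  - (g z)^-2 * partial i g z * partial j g z)).
  by near=> y; rewrite partial2_lng//; near: y; exact: near_H.
have gc : g y @[y --> z] --> g z by exact/differentiable_continuous/g_differentiable.
have g0 : g z != 0 by rewrite gt_eqF// g_gt0.
apply: cvgB; apply: cvgM.
- exact: cvgV.
- exact/differentiable_continuous/partial2_differentiable.
- apply: cvgM; last exact/differentiable_continuous/partial_differentiable.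
  by apply: cvgV; [rewrite expf_neq0|under eq_fun do rewrite expr2; exact: cvgM].
- exact/differentiable_continuous/partial_differentiable.
Unshelve. all: by end_near. Qed.

End LogMetric.

(** * Metrics that vanish on the axis *)

Section Axis.
Context {R : realType}.
Local Notation vec := 'rV[R]_2.
Implicit Types (z u v : vec) (i j : 'I_2).

Lemma is_derive_coord z v i :
  is_derive z v (fun y : vec => y 0 i) (v 0 i).
Proof.
split; first by apply: diff_derivable; exact: differentiable_coord.
apply/cvg_lim => //; apply: cvg_near_cst; near=> h.
have h0 : h != 0 by near: h; exact: nbhs_dnbhs_neq.
by rewrite /= !mxE addrK /GRing.scale/= mulrA mulVf ?mul1r.
Unshelve. all: by end_near. Qed.

Lemma dot_e1 z : z *d vec_e1 = z 0 0.
Proof. by rewrite dotE !mxE/= mulr1 mulr0 addr0. Qed.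

Lemma mulmxvE (A : 'M[R]_2) u i : mulmxv A u 0 i = A i 0 * u 0 0 + A i 1 * u 0 1.
Proof.
rewrite /mulmxv !mxE big_ord_recl big_ord1 !mxE; congr (_ * _ + _ * _);
  by [congr (_ _ _); apply/val_inj | congr (_ 0 _); apply/val_inj].
Qed.

Lemma mulmxv_dot (A : 'M[R]_2) y v :
  mulmxv A y *d v = (A 0 0 * v 0 0 + A 1 0 * v 0 1) * y 0 0 +
                    (A 0 1 * v 0 0 + A 1 1 * v 0 1) * y 0 1.
Proof. by rewrite dotE (mulmxvE _ _ 0) (mulmxvE _ _ 1); ring. Qed.
(** The Hessian applied to [y] pairs with [v] as the derivative in the direction
    [v] of the gradient paired with the constant vector [y]. *)
Lemma hess_dot (f : vec -> R) z y v :
  mulmxv (hess f z) y *d v =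
  grad (partial 0 f) z *d v * y 0 0 + grad (partial 1 f) z *d v * y 0 1.
Proof.
have hE i j : hess f z i j = grad (partial j f) z 0 i.
  by rewrite [LHS]mxE [RHS]mxE.
rewrite [LHS]mulmxv_dot.
by congr (_ * _ + _ * _); rewrite [RHS]dotE; congr (_ * _ + _ * _); exact: hE.
Qed.

(** Both families of degenerate metrics have the form
    [z_1 ^ c * exp (- e |z|^2)], with [e = 0] for the power metrics; they are
    treated together from here on. *)
Lemma axis_metricE (H : set vec) (g : vec -> R) : axis_metric H g ->
  exists2 c : R, 0 < c & exists e : R, forall z, H z ->
    0 < z 0 0 /\ g z = z 0 0 `^ c * expR (- (e * (z *d z))).
Proof.
case=> HE gE _.
have Hz1 z : H z -> 0 < z 0 0 by rewrite HE /= dot_e1.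
case: gE => [[mu mu1 gE]|[n n2 gE]].
  exists (- 2 * mu); first by lra.
  exists 0 => z Hz; split; first exact: Hz1.
  by rewrite gE// mul0r oppr0 expR0 mulr1 dot_e1.
exists (2 * (n - 1))%:R; first by rewrite ltr0n muln_gt0/= subn_gt0.
exists 2^-1 => z Hz; split; first exact: Hz1.
rewrite gE// powR_mulrn ?ltW ?Hz1// dot_e1; congr (_ * expR _).
rewrite mulNr /enorm sqr_sqrtr// dotE addr_ge0// -expr2 sqr_ge0//.
Qed.

Section Explicit.
Variables (H : set vec) (g : vec -> R) (c e : R).
Hypotheses (hg : metric H g)
  (gE : forall z, H z ->
    0 < z 0 0 /\ g z = z 0 0 `^ c * expR (- (e * (z *d z)))).
Local Notation lng := (fun z => ln (g z)).

Lemma axis_lng z : H z -> ln (g z) = c * ln (z 0 0) - e * (z *d z).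
Proof.
move=> Hz; have [z0 ->] := gE Hz.
by rewrite lnM ?posrE ?powR_gt0 ?expR_gt0// ln_powR expRK.
Qed.

Lemma axis_partial i z : H z ->
  partial i lng z = c * (basis_vec i 0 0 / z 0 0) - 2 * e * (z *d basis_vec i).
Proof.
move=> Hz; have [z0 _] := gE Hz; rewrite /partial.
rewrite -(@near_eq_derive _ _ _ (fun z : vec =>
  c *: ln (z 0 0) - e *: (z 0 0 * z 0 0 + z 0 1 * z 0 1))); last first.
  by apply: filterS (near_H hg Hz) => y Hy; rewrite axis_lng// dotE.
set b := basis_vec i.
have d0 := is_derive_coord z b 0; have d1 := is_derive_coord z b 1.
have dl := is_derive_comp1 (differentiable_coord z 0 0) d0 (is_derive1_ln z0).
have D := is_deriveB (is_deriveZ c dl)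
  (is_deriveZ e (is_deriveD (is_deriveM d0 d0) (is_deriveM d1 d1))).
have [_ ->] := D.
rewrite dotE /GRing.scale/=; ring.
Qed.

Lemma axis_partial2 i j z : H z ->
  partial i (partial j lng) z =
  - (c * (basis_vec i 0 0 * basis_vec j 0 0 / z 0 0 ^+ 2))
  - 2 * e * (basis_vec i *d basis_vec j).
Proof.
move=> Hz; have [z0 _] := gE Hz; rewrite {1}/partial.
set bj := basis_vec j.
rewrite -(@near_eq_derive _ _ _ (fun z : vec =>
  (c * bj 0 0) *: (z 0 0)^-1
  - (2 * e) *: (bj 0 0 *: z 0 0 + bj 0 1 *: z 0 1))); last first.
  apply: filterS (near_H hg Hz) => y Hy; rewrite axis_partial// dotE -/bj.
  rewrite /GRing.scale/=; ring.
set b := basis_vec i.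
have d0 := is_derive_coord z b 0; have d1 := is_derive_coord z b 1.
have zn0 : z 0 0 != 0 by rewrite gt_eqF.
have dV := is_derive_comp1 (differentiable_coord z 0 0) d0
  (is_deriveV zn0 (is_derive_id (z 0 0) 1)).
have D := is_deriveB (is_deriveZ (c * bj 0 0) dV)
  (is_deriveZ (2 * e) (is_deriveD (is_deriveZ (bj 0 0) d0) (is_deriveZ (bj 0 1) d1))).
have [_ ->] := D.
rewrite dotE /GRing.scale/=; field.
by [].
Qed.

Lemma axis_grad z u : H z ->
  grad lng z *d u = c * (u 0 0 / z 0 0) - 2 * e * (z *d u).
Proof. move=> Hz; rewrite !dotE !mxE !axis_partial// !dotE !mxE/=; ring. Qed.

Lemma axis_hess z u v : H z ->
  mulmxv (hess lng z) u *d v =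
  - (c * ((u 0 0 / z 0 0) * (v 0 0 / z 0 0))) - 2 * e * (u *d v).
Proof.
move=> Hz; have [z0 _] := gE Hz.
have zn0 : z 0 0 != 0 by rewrite gt_eqF.
rewrite [X in X = _]mulmxv_dot.
rewrite ![hess _ _ _ _]mxE !axis_partial2// !dotE !mxE/=; field.
by [].
Qed.

End Explicit.
End Axis.

(** * Limits along a curve *)

(** What a solution satisfies at each fixed time, apart from its equations. *)
Definition admissible_curve {R : realType} (H : set 'rV[R]_2)
    (I : param_domain) (d0 : set R) (J : nat) (x : R -> 'rV[R]_2) : Prop :=
  [/\ Vh2 I J x,
      forall p, d0 p -> x p *d vec_e1 = 0,
      forall r : R, r \in `[0, 1] -> ~ d0 r -> H (x r)
    & forall j (r : R), (j < J)%N -> r \in `]node J j, node J j.+1[ ->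
        0 < speed x r].

Section CurveLimits.
Context {R : realType}.
Local Notation vec := 'rV[R]_2.

Lemma cvg_coord {S : Type} (F : set_system S) (u : S -> vec) (b : vec) i :
  u r @[r --> F] --> b -> u r 0 i @[r --> F] --> b 0 i.
Proof. by move=> ub; exact: (cvg_comp _ _ ub (@coord_continuous R 1 2 0 i b)). Qed.

Lemma cvg_dot {S : Type} (F : set_system S) {FF : Filter F} (u v : S -> vec)
    (a b : vec) :
  u r @[r --> F] --> a -> v r @[r --> F] --> b ->
  (u r *d v r) @[r --> F] --> a *d b.
Proof.
move=> ua vb; rewrite dotE; under eq_fun do rewrite dotE.
by apply: cvgD; apply: cvgM; exact: cvg_coord.
Qed.

Variables (H : set vec) (g : vec -> R).
Hypothesis hg : metric H g.
Variables (I : param_domain) (d0 dC dN : set R).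
Hypotheses (hI : boundary_partition I d0 dC dN)
  (h0 : d0 !=set0 -> axis_metric H g).
Variables (J j : nat).
Hypothesis jJ : (j < J)%N.
Variable a : R.
Hypothesis a01 : 0 <= a <= 1.
Variable x : R -> vec.
Hypothesis xC : admissible_curve H I d0 J x.

Let xV : Vh2 I J x. Proof. by case: xC. Qed.
Let xd0 p : d0 p -> x p *d vec_e1 = 0. Proof. by case: xC => _ + _ _; exact. Qed.
Let xH r : r \in `[0, 1] -> ~ d0 r -> H (x r).
Proof. by case: xC => _ _ + _; exact. Qed.

Local Notation lng := (fun z => ln (g z)).
Local Notation F := (elem_filter J j a).
Local Notation q := (quad_point J j a).
Local Notation p := (slope J j x).

Lemma axis_point_endpoint r : d0 r -> r = 0 \/ r = 1.
Proof.
move=> r0; have : bdry I r by case: hI => <- _ _ _; left; left.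
by case: I.
Qed.

Lemma elem_notin_d0 (r : R) : r \in `]node J j, node J j.+1[ -> ~ d0 r.
Proof.
rewrite in_itv/= => /andP[r1 r2] /axis_point_endpoint.
have := @node_ge0 R J j; have := @node_le1 R J j jJ.
by move=> n1 n0 [|] rE; move: r1 r2; rewrite rE; lra.
Qed.

Lemma elem_in01 (r : R) : r \in `[node J j, node J j.+1] -> r \in `[0, 1].
Proof.
rewrite !in_itv/= => /andP[r1 r2].
have := @node_ge0 R J j; have := @node_le1 R J j jJ.
by move=> n1 n0; apply/andP; split; lra.
Qed.

Lemma elem_H (r : R) : r \in `]node J j, node J j.+1[ -> H (x r).
Proof.
move=> rI; apply: xH; last exact: elem_notin_d0.
by apply: elem_in01; exact: subset_itv_oo_cc rI.
Qed.

Lemma quad_point_H : ~ d0 q -> H (x q).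
Proof. by apply: xH; apply: elem_in01; exact: quad_point_in. Qed.

Lemma slope_norm_gt0 : 0 < enorm p.
Proof.
have [r rI] := filter_ex (near_elem jJ a01).
by case: xC => _ _ _ /(_ j r jJ rI); rewrite /speed (Vh2_derive1 jJ xV).
Qed.

Lemma coord0_affine (y : R -> vec) (r : R) : Vh2 I J y -> d0 q -> y q *d vec_e1 = 0 ->
  r \in `]node J j, node J j.+1[ -> y r 0 0 = (r - q) * slope J j y 0 0.
Proof.
move=> yV qd0; rewrite dot_e1 => y0 rI.
rewrite (@Vh2_affine _ I J j jJ y q r)//.
- by rewrite !mxE y0 add0r.
- exact: quad_point_in.
- exact: subset_itv_oo_cc rI.
Qed.

(** This constant quotient is what cancels the pole of grad (ln g) at an endpoint
    on the axis. *)
Lemma coord0_ratio (y : R -> vec) (r : R) : Vh2_0 I d0 J y -> d0 q ->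
  r \in `]node J j, node J j.+1[ -> 0 < x r 0 0 ->
  y r 0 0 / x r 0 0 = slope J j y 0 0 / p 0 0.
Proof.
move=> [yV y0] qd0 rI.
rewrite (coord0_affine xV qd0 (xd0 qd0) rI) (coord0_affine yV qd0 (y0 _ qd0) rI).
move=> x0.
have : (r - q) * p 0 0 != 0 by rewrite gt_eqF.
by rewrite mulf_eq0 negb_or => /andP[rq p0]; field; rewrite p0 rq.
Qed.

(** At an endpoint on the axis [g] need not be continuous as a function on the
    plane; the limit is taken along the curve, on which [g] is given by the
    explicit formula. *)
Lemma cvg_g : g (x r) @[r --> F] --> g (x q).
Proof.
have xq := Vh2_cvg jJ a01 xV.
have [qd0|qd0] := pselect (d0 q); last first.
  exact: (cvg_comp _ _ xq
    (differentiable_continuous (g_differentiable hg (quad_point_H qd0)))).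
have ax := h0 (ex_intro _ q qd0).
have [c c0 [e gE]] := axis_metricE ax.
have -> : g (x q) = 0 by case: ax => _ _; apply; exact: xd0.
apply: (@elem_cvg_near _ _ _ jJ _ a01 _ _
  (fun r => x r 0 0 `^ c * expR (- (e * (x r *d x r))))).
  by move=> r rI; have [_ ->] := gE _ (elem_H rI).
have -> : 0 = 0 * expR (- (e * (x q *d x q))) by rewrite mul0r.
apply: cvgM.
  apply: (cvg_comp _ _ _ (powR_cvg0 c0)) => A A0.
  have xq0 : x q 0 0 = 0 by rewrite -dot_e1 xd0.
  have := cvg_coord (i := 0) xq; rewrite xq0 => /(_ _ A0) xA.
  suff : \forall r \near F, A (x r 0 0) by [].
  have {}xA : \forall r \near F, 0 < x r 0 0 -> A (x r 0 0) by [].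
  near=> r; have rI : r \in `]node J j, node J j.+1[ by near: r; exact: (near_elem jJ a01).
  have [x0 _] := gE _ (elem_H rI).
  by apply: (near xA r).
have xx : - (e * (x r *d x r)) @[r --> F] --> - (e * (x q *d x q)).
  by apply: cvgN; apply: cvgMr; exact: cvg_dot.
exact: (cvg_comp _ _ xx (@continuous_expR R _)).
Unshelve. all: by end_near. Qed.

(** The limit is an unspecified number at endpoints on the axis: only its
    existence matters there, since it gets multiplied by g^(1/2) = 0. *)
Lemma cvg_grad_dot (y : R -> vec) : Vh2_0 I d0 J y ->
  exists2 l, (grad lng (x r) *d y r) @[r --> F] --> l &
    (~ d0 q -> l = grad lng (x q) *d y q).
Proof.
move=> y0; have xq := Vh2_cvg jJ a01 xV; have yq := Vh2_cvg jJ a01 y0.1.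
have [qd0|qd0] := pselect (d0 q); last first.
  eexists; last by [].
  have C i : grad lng (x r) 0 i @[r --> F] --> grad lng (x q) 0 i.
    rewrite mxE; under eq_fun do rewrite mxE.
    exact: (cvg_comp _ _ xq (differentiable_continuous
      (partial_lng_differentiable hg i (quad_point_H qd0)))).
  rewrite dotE; under eq_fun do rewrite dotE.
  by apply: cvgD; apply: cvgM; [|exact: cvg_coord| |exact: cvg_coord].
have ax := h0 (ex_intro _ q qd0).
have [c c0 [e gE]] := axis_metricE ax.
exists (c * (slope J j y 0 0 / p 0 0) - 2 * e * (x q *d y q)) => //.
apply: (@elem_cvg_near _ _ _ jJ _ a01 _ _
  (fun r => c * (slope J j y 0 0 / p 0 0) - 2 * e * (x r *d y r))).
  move=> r rI; rewrite (axis_grad hg gE)//; last exact: elem_H.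
  by rewrite (coord0_ratio y0)//; have [] := gE _ (elem_H rI).
by apply: cvgB; [exact: cvg_cst|apply: cvgMr; exact: cvg_dot].
Qed.

Lemma cvg_hess_dot (y v : R -> vec) : Vh2_0 I d0 J y -> Vh2_0 I d0 J v ->
  exists2 l, (mulmxv (hess lng (x r)) (y r) *d v r) @[r --> F] --> l &
    (~ d0 q -> l = mulmxv (hess lng (x q)) (y q) *d v q).
Proof.
move=> y0 v0; have xq := Vh2_cvg jJ a01 xV.
have yq := Vh2_cvg jJ a01 y0.1; have vq := Vh2_cvg jJ a01 v0.1.
have [qd0|qd0] := pselect (d0 q); last first.
  eexists; last by [].
  have C i k : hess lng (x r) i k @[r --> F] --> hess lng (x q) i k.
    rewrite mxE; under eq_fun do rewrite mxE.
    exact: (cvg_comp _ _ xq (hess_lng_continuous hg (quad_point_H qd0))).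
  rewrite [X in _ --> X]mulmxv_dot; under eq_fun do rewrite mulmxv_dot.
  by apply: cvgD; apply: cvgM; do ?exact: cvg_coord; apply: cvgD;
    apply: cvgM => //; exact: cvg_coord.
have ax := h0 (ex_intro _ q qd0).
have [c c0 [e gE]] := axis_metricE ax.
exists (- (c * ((slope J j y 0 0 / p 0 0) * (slope J j v 0 0 / p 0 0)))
  - 2 * e * (y q *d v q)) => //.
apply: (@elem_cvg_near _ _ _ jJ _ a01 _ _
  (fun r => - (c * ((slope J j y 0 0 / p 0 0) * (slope J j v 0 0 / p 0 0)))
  - 2 * e * (y r *d v r))).
  move=> r rI; rewrite (axis_hess hg gE)//; last exact: elem_H.
  have [r0 _] := gE _ (elem_H rI).
  by rewrite (coord0_ratio y0)// (coord0_ratio v0).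
by apply: cvgB; [exact: cvg_cst|apply: cvgMr; exact: cvg_dot].
Qed.

End CurveLimits.

(** * The terms of the scheme at a quadrature point *)

Section QuadPointTerms.
Context {R : realType}.
Variables (g : 'rV[R]_2 -> R) (J : nat) (x : R -> 'rV[R]_2) (kap : R -> R).
Variables (y v : R -> 'rV[R]_2) (chi : R -> R) (j : nat) (a : R).
Local Notation lng := (fun z => ln (g z)).
Local Notation ev f := (elem_value J f j a).

Definition energy_at : R := ev (fun r => kap r ^+ 2 * gspeed g x r).

Definition side_at : R :=
  ev (fun r => (Num.sqrt (g (x r)) * kap r) *: nu x r *d (gspeed g x r *: y r))
  + ev (fun r => ds x x r *d (gspeed g x r *: ds x y r))
  + 2^-1 * ev (fun r => grad lng (x r) *d (gspeed g x r *: y r)).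

Definition curvature_at : R :=
  ev (fun r => (kap r - Num.sqrt (g (x r)) * (y r *d nu x r)) *
               (chi r * gspeed g x r)).

(** The right-hand side of the equation of motion tested with [v], to which the
    second term of its left-hand side has been moved; what remains on the left
    is the dissipation term. *)
Definition motion_at : R :=
  ev (fun r => (ds x y r *d nu x r) * ((ds x v r *d nu x r) * gspeed g x r))
  - 2^-1 * ev (fun r => (kap r ^+ 2 - y r *d grad lng (x r)) *
      ((ds x v r *d tau x r + 2^-1 * (v r *d grad lng (x r))) * gspeed g x r))
  + 2^-1 * ev (fun r => mulmxv (hess lng (x r)) (y r) *d (gspeed g x r *: v r))
  + ev (fun r => (Num.sqrt (g (x r)) * kap r * (y r *d nu x r) +
                  2^-1 * (ds x y r *d tau x r)) *
                 ((v r *d grad lng (x r)) * gspeed g x r))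
  + ev (fun r => Num.sqrt (g (x r)) * kap r *
                 ((ds x v r *d perp (y r)) * gspeed g x r)).

End QuadPointTerms.

Section Densities.
Context {R : realType}.
Local Notation vec := 'rV[R]_2.
Variables (H : set vec) (g : vec -> R).
Hypothesis hg : metric H g.
Variables (I : param_domain) (d0 dC dN : set R).
Hypotheses (hI : boundary_partition I d0 dC dN)
  (h0 : d0 !=set0 -> axis_metric H g).
Variables (J j : nat).
Hypothesis jJ : (j < J)%N.
Variable a : R.
Hypothesis a01 : 0 <= a <= 1.
Variable x : R -> vec.
Hypothesis xC : admissible_curve H I d0 J x.
Local Notation lng := (fun z => ln (g z)).
Local Notation F := (elem_filter J j a).
Local Notation q := (quad_point J j a).
Local Notation slope := (slope J j).
Local Notation p := (slope x).
Local Notation L := (enorm p).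
Local Notation s := (Num.sqrt (g (x q))).
Local Notation ev f := (elem_value J f j a).

(** The values of [y . grad (ln g)] and [(D^2 ln g) y . v] at the quadrature
    point, in a form that also makes sense on the axis. *)
Definition glog (y : R -> vec) : R := lim ((grad lng (x r) *d y r) @[r --> F]).
Definition hlog (y v : R -> vec) : R :=
  lim ((mulmxv (hess lng (x r)) (y r) *d v r) @[r --> F]).

Lemma glog_cvg (y : R -> vec) : Vh2_0 I d0 J y ->
  (grad lng (x r) *d y r) @[r --> F] --> glog y.
Proof.
move=> y0; have [l yl _] := cvg_grad_dot hg hI h0 jJ a01 xC y0.
by rewrite /glog (cvg_lim _ yl).
Qed.

Lemma glogE (y : R -> vec) : Vh2_0 I d0 J y -> ~ d0 q ->
  glog y = grad lng (x q) *d y q.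
Proof.
move=> y0 qd0; have [l yl <-//] := cvg_grad_dot hg hI h0 jJ a01 xC y0.
exact: cvg_lim.
Qed.

Lemma hlog_cvg (y v : R -> vec) : Vh2_0 I d0 J y -> Vh2_0 I d0 J v ->
  (mulmxv (hess lng (x r)) (y r) *d v r) @[r --> F] --> hlog y v.
Proof.
move=> y0 v0; have [l yl _] := cvg_hess_dot hg hI h0 jJ a01 xC y0 v0.
by rewrite /hlog (cvg_lim _ yl).
Qed.

Lemma hlogE (y v : R -> vec) : Vh2_0 I d0 J y -> Vh2_0 I d0 J v -> ~ d0 q ->
  hlog y v = mulmxv (hess lng (x q)) (y q) *d v q.
Proof.
move=> y0 v0 qd0; have [l yl <-//] := cvg_hess_dot hg hI h0 jJ a01 xC y0 v0.
exact: cvg_lim.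
Qed.

Lemma dotZr (c : R) (u v : vec) : u *d (c *: v) = c * (u *d v).
Proof. by rewrite !dotE !mxE; ring. Qed.

Lemma dotC (u v : vec) : u *d v = v *d u.
Proof. by rewrite !dotE; ring. Qed.

Lemma enorm_sqr (u : vec) : enorm u ^+ 2 = u *d u.
Proof. by rewrite sqr_sqrtr// dotE addr_ge0// -expr2 sqr_ge0. Qed.

Lemma sqrt_g_cvg : Num.sqrt (g (x r)) @[r --> F] --> s.
Proof. exact: (cvg_comp _ _ (cvg_g hg hI h0 jJ a01 xC) (@sqrt_continuous R _)). Qed.

Let L0 : L != 0.
Proof. by rewrite gt_eqF// (slope_norm_gt0 jJ a01 xC). Qed.

Let xV : Vh2 I J x. Proof. by case: xC. Qed.

Lemma speedE (r : R) : r \in `]node J j, node J j.+1[ -> speed x r = L.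
Proof. by move=> rI; rewrite /speed (Vh2_derive1 jJ xV). Qed.

Lemma gspeed_cvg : gspeed g x r @[r --> F] --> s * L.
Proof.
apply: (elem_cvg_near jJ a01 (f' := fun r => Num.sqrt (g (x r)) * L)).
  by move=> r rI; rewrite /gspeed speedE.
by apply: cvgMl; exact: sqrt_g_cvg.
Qed.

Lemma ds_cvg (y : R -> vec) : Vh2 I J y ->
  ds x y r @[r --> F] --> L^-1 *: slope y.
Proof.
move=> yV; apply: (elem_cvg_near jJ a01 (f' := fun=> L^-1 *: slope y)).
  by move=> r rI; rewrite /ds speedE// (Vh2_derive1 jJ yV).
exact: cvg_cst.
Qed.

Lemma nu_cvg : nu x r @[r --> F] --> - perp (L^-1 *: p).
Proof.
apply: (elem_cvg_near jJ a01 (f' := fun=> - perp (L^-1 *: p))).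
  by move=> r rI; rewrite /nu /tau /ds speedE// (Vh2_derive1 jJ xV).
exact: cvg_cst.
Qed.

Lemma dot_perp_cvg (u y : R -> vec) (b : vec) : Vh2 I J y ->
  u r @[r --> F] --> b -> (u r *d perp (y r)) @[r --> F] --> b *d perp (y q).
Proof.
move=> yV ub; have yq := Vh2_cvg jJ a01 yV.
rewrite dotE !mxE/=; under eq_fun do rewrite dotE !mxE/=.
by apply: cvgD; apply: cvgM; [exact: cvg_coord|exact: cvg_coord|exact: cvg_coord|
  apply: cvgN; exact: cvg_coord].
Qed.

(** The scalar product of [v] with [u] turned counterclockwise by pi/2; hence
    [cross X_rho y = |X_rho| (nu . y)]. *)
Definition cross (u v : vec) : R := u 0 0 * v 0 1 - u 0 1 * v 0 0.

Section Terms.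
Variables (kap chi : R -> R) (y v : R -> vec).
Hypotheses (kV : Vh I J kap) (chiV : Vh I J chi).
Hypotheses (y0 : Vh2_0 I d0 J y) (v0 : Vh2_0 I d0 J v).
Let yV : Vh2 I J y. Proof. by case: y0. Qed.
Let vV : Vh2 I J v. Proof. by case: v0. Qed.
Local Notation kq := (kap q).

Lemma energy_atE : energy_at g J x kap j a = kq ^+ 2 * (s * L).
Proof.
apply: elem_value_cvg; rewrite expr2; under eq_fun do rewrite expr2.
by apply: cvgM; [apply: cvgM; exact: (Vh_cvg jJ a01 kV)|exact: gspeed_cvg].
Qed.

Lemma side_atE : side_at g J x kap y j a
  = s ^+ 2 * kq * cross p (y q) + s / L * (p *d slope y) + 2^-1 * (glog y * (s * L)).
Proof.
have kc := Vh_cvg jJ a01 kV; have yc := Vh2_cvg jJ a01 yV.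
have c1 : ((Num.sqrt (g (x r)) * kap r) *: nu x r *d (gspeed g x r *: y r))
    @[r --> F] --> ((s * kq) *: - perp (L^-1 *: p)) *d ((s * L) *: y q).
  apply: cvg_dot; apply: cvgZ => //; [|exact: nu_cvg|exact: gspeed_cvg].
  by apply: cvgM => //; exact: sqrt_g_cvg.
have c2 : (ds x x r *d (gspeed g x r *: ds x y r))
    @[r --> F] --> (L^-1 *: p) *d ((s * L) *: (L^-1 *: slope y)).
  apply: cvg_dot; first exact: ds_cvg.
  by apply: cvgZ; [exact: gspeed_cvg|exact: ds_cvg].
have c3 : (grad lng (x r) *d (gspeed g x r *: y r)) @[r --> F] --> glog y * (s * L).
  under eq_fun do rewrite dotZr mulrC.
  by apply: cvgM; [exact: glog_cvg|exact: gspeed_cvg].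
rewrite /side_at (elem_value_cvg c1) (elem_value_cvg c2) (elem_value_cvg c3).
rewrite /cross !dotE !mxE/= ?mxE; field.
exact: L0.
Qed.

Lemma curvature_atE : curvature_at g J x kap y chi j a
  = (kq - s / L * cross p (y q)) * chi q * (s * L).
Proof.
have kc := Vh_cvg jJ a01 kV; have yc := Vh2_cvg jJ a01 yV.
have c1 : ((kap r - Num.sqrt (g (x r)) * (y r *d nu x r)) * (chi r * gspeed g x r))
    @[r --> F] --> (kq - s * (y q *d - perp (L^-1 *: p))) * (chi q * (s * L)).
  apply: cvgM; last by apply: cvgM; [exact: (Vh_cvg jJ a01 chiV)|exact: gspeed_cvg].
  apply: cvgB => //; apply: cvgM; first exact: sqrt_g_cvg.
  by apply: cvg_dot => //; exact: nu_cvg.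
rewrite /curvature_at (elem_value_cvg c1) /cross !dotE !mxE/= ?mxE; field.
exact: L0.
Qed.

Lemma ev_bending :
  ev (fun r => (ds x y r *d nu x r) * ((ds x v r *d nu x r) * gspeed g x r))
  = s / L * (slope v *d slope y) - s / L ^+ 3 * (p *d slope y) * (p *d slope v).
Proof.
have c1 : ((ds x y r *d nu x r) * ((ds x v r *d nu x r) * gspeed g x r))
    @[r --> F] --> (L^-1 *: slope y *d - perp (L^-1 *: p)) *
                   ((L^-1 *: slope v *d - perp (L^-1 *: p)) * (s * L)).
  by apply: cvgM; [|apply: cvgM; last exact: gspeed_cvg];
    (apply: cvg_dot; [exact: ds_cvg|exact: nu_cvg]).
rewrite (elem_value_cvg c1).
(* multiplying the first summand by |p|^2 / L^2 = 1 makes this Lagrange's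
   identity in the plane *)
have -> : s / L * (slope v *d slope y) =
          s / L ^+ 3 * (slope v *d slope y) * (p *d p).
  by rewrite -enorm_sqr; field; exact: L0.
rewrite !dotE !mxE/= ?mxE; field.
exact: L0.
Qed.

Lemma ev_length :
  ev (fun r => (kap r ^+ 2 - y r *d grad lng (x r)) *
    ((ds x v r *d tau x r + 2^-1 * (v r *d grad lng (x r))) * gspeed g x r))
  = (kq ^+ 2 - glog y) * ((p *d slope v) / L ^+ 2 + 2^-1 * glog v) * (s * L).
Proof.
have kc := Vh_cvg jJ a01 kV.
have c1 : ((kap r ^+ 2 - y r *d grad lng (x r)) *
    ((ds x v r *d tau x r + 2^-1 * (v r *d grad lng (x r))) * gspeed g x r))
  @[r --> F] --> (kq ^+ 2 - glog y) *
    ((L^-1 *: slope v *d (L^-1 *: p) + 2^-1 * glog v) * (s * L)).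
  apply: cvgM.
    apply: cvgB; last by under eq_fun do rewrite dotC; exact: glog_cvg.
    by rewrite expr2; under eq_fun do rewrite expr2; exact: cvgM.
  apply: cvgM; last exact: gspeed_cvg.
  apply: cvgD; first by apply: cvg_dot; exact: ds_cvg.
  by apply: cvgMr; under eq_fun do rewrite dotC; exact: glog_cvg.
rewrite (elem_value_cvg c1) !dotE !mxE; field.
exact: L0.
Qed.

Lemma ev_hessian :
  ev (fun r => mulmxv (hess lng (x r)) (y r) *d (gspeed g x r *: v r))
  = hlog y v * (s * L).
Proof.
apply: elem_value_cvg; under eq_fun do rewrite dotZr mulrC.
by apply: cvgM; [exact: hlog_cvg|exact: gspeed_cvg].
Qed.

Lemma ev_gradient :
  ev (fun r => (Num.sqrt (g (x r)) * kap r * (y r *d nu x r) +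
                2^-1 * (ds x y r *d tau x r)) *
               ((v r *d grad lng (x r)) * gspeed g x r))
  = (s * kq / L * cross p (y q) + 2^-1 * (p *d slope y) / L ^+ 2) *
    glog v * (s * L).
Proof.
have kc := Vh_cvg jJ a01 kV; have yc := Vh2_cvg jJ a01 yV.
have c1 : ((Num.sqrt (g (x r)) * kap r * (y r *d nu x r) +
    2^-1 * (ds x y r *d tau x r)) * ((v r *d grad lng (x r)) * gspeed g x r))
  @[r --> F] --> (s * kq * (y q *d - perp (L^-1 *: p)) +
    2^-1 * (L^-1 *: slope y *d (L^-1 *: p))) * (glog v * (s * L)).
  apply: cvgM.
    apply: cvgD; last by apply: cvgMr; apply: cvg_dot; exact: ds_cvg.
    apply: cvgM; last by apply: cvg_dot => //; exact: nu_cvg.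
    by apply: cvgM => //; exact: sqrt_g_cvg.
  apply: cvgM; last exact: gspeed_cvg.
  by under eq_fun do rewrite dotC; exact: glog_cvg.
rewrite (elem_value_cvg c1) /cross !dotE !mxE/= ?mxE; field.
exact: L0.
Qed.

Lemma ev_rotation :
  ev (fun r => Num.sqrt (g (x r)) * kap r *
               ((ds x v r *d perp (y r)) * gspeed g x r))
  = s ^+ 2 * kq * cross (slope v) (y q).
Proof.
have c1 : (Num.sqrt (g (x r)) * kap r * ((ds x v r *d perp (y r)) * gspeed g x r))
  @[r --> F] --> s * kq * ((L^-1 *: slope v *d perp (y q)) * (s * L)).
  apply: cvgM.
    by apply: cvgM; [exact: sqrt_g_cvg|exact: (Vh_cvg jJ a01 kV)].
  apply: cvgM; last exact: gspeed_cvg.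
  by apply: dot_perp_cvg => //; exact: ds_cvg.
rewrite (elem_value_cvg c1) /cross !dotE !mxE/=; field.
exact: L0.
Qed.

Lemma motion_atE : motion_at g J x kap y v j a
  = (s / L * (slope v *d slope y)
     - s / L ^+ 3 * (p *d slope y) * (p *d slope v))
  - 2^-1 * ((kq ^+ 2 - glog y) *
      ((p *d slope v) / L ^+ 2 + 2^-1 * glog v) * (s * L))
  + 2^-1 * (hlog y v * (s * L))
  + (s * kq / L * cross p (y q) + 2^-1 * (p *d slope y) / L ^+ 2) *
    glog v * (s * L)
  + s ^+ 2 * kq * cross (slope v) (y q).
Proof.
by rewrite /motion_at ev_bending ev_length ev_hessian ev_gradient ev_rotation.
Qed.

End Terms.
End Densities.

(** * Time derivatives at a quadrature point *)

Section Evolution.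
Context {R : realType}.
Local Notation vec := 'rV[R]_2.
Variables (H : set vec) (g : vec -> R).
Hypothesis hg : metric H g.
Variables (I : param_domain) (d0 dC dN : set R).
Hypotheses (hI : boundary_partition I d0 dC dN)
  (h0 : d0 !=set0 -> axis_metric H g).
Variables (J j : nat).
Hypothesis jJ : (j < J)%N.
Variable a : R.
Hypothesis a01 : 0 <= a <= 1.
Variables (T : R) (X : R -> R -> vec) (kap : R -> R -> R) (t : R).
Hypothesis tT : t \in `]0, T].
Hypotheses
  (XC : forall s : R, s \in `]0, T] -> admissible_curve H I d0 J (X s))
  (kV : forall s : R, s \in `]0, T] -> Vh I J (kap s)).
Variables (v y : R -> vec) (kt : R -> R).
Hypotheses
  (Xt : forall r : R, r \in `[0, 1] -> has_tderiv T (fun s => X s r) t (v r))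
  (kapt : forall r : R, r \in `[0, 1] -> has_tderiv T (fun s => kap s r) t (kt r))
  (v0 : Vh2_0 I d0 J v) (y0 : Vh2_0 I d0 J y) (ktV : Vh I J kt).
Local Notation lng := (fun z => ln (g z)).
Local Notation q := (quad_point J j a).
Local Notation slope := (slope J j).
Local Notation ev f := (elem_value J f j a).
Local Notation x := (X t).
Local Notation p := (slope x).
Local Notation L := (enorm p).
Local Notation S := (Num.sqrt (g (x q))).
Local Notation kq := (kap t q).
Local Notation gl := (glog g J j a x).
Local Notation hl := (hlog g J j a x).
Local Notation D f l := (has_tderiv T f t l).

Let xC := XC tT.
Let q01 : q \in `[0, 1].
Proof. by apply: (elem_in01 jJ); exact: quad_point_in. Qed.

Lemma tderiv_coord (f : R -> vec) l i : D f l -> D (fun s => f s 0 i) (l 0 i).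
Proof.
move=> fl; have := has_tderiv_comp tT fl (differentiable_coord (f t) 0 i).
by have [_ ->] := is_derive_coord (f t) l i.
Qed.

Lemma tderiv_slope i : D (fun s => slope (X s) 0 i) (slope v 0 i).
Proof.
have n01 k : (k <= J)%N -> (node J k : R) \in `[0, 1].
  move=> kJ; rewrite in_itv/= /node; apply/andP; split.
    by rewrite mulr_ge0.
  by rewrite ler_pdivrMr ?mul1r ?ler_nat// ltr0n (leq_ltn_trans _ jJ).
have C k : (k <= J)%N -> D (fun s => X s (node J k) 0 i) (v (node J k) 0 i).
  by move=> kJ; apply: tderiv_coord; apply: Xt; exact: n01.
have := has_tderivM tT (has_tderiv_cst T (J%:R : R) t)
  (has_tderivD (C _ jJ) (has_tderivM tT (has_tderiv_cst T (-1 : R) t) (C _ (ltnW jJ)))).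
rewrite !mul0r !add0r !mulN1r => h.
have slopeE (f : R -> vec) :
    slope f 0 i = J%:R * (f (node J j.+1) 0 i - f (node J j) 0 i).
  by rewrite !mxE.
by rewrite slopeE; apply: eq_has_tderiv h => s sT; rewrite slopeE mulN1r.
Qed.

Lemma tderiv_norm : D (fun s => enorm (slope (X s))) (p *d slope v / L).
Proof.
have pp : 0 < p *d p.
  by rewrite -enorm_sqr exprn_gt0// (slope_norm_gt0 jJ a01 xC).
have C i := tderiv_slope i.
have dd : D (fun s => slope (X s) *d slope (X s)) (2 * (p *d slope v)).
  have := has_tderivD (has_tderivM tT (C 0) (C 0)) (has_tderivM tT (C 1) (C 1)).
  have -> : 2 * (p *d slope v) = slope v 0 0 * p 0 0 + p 0 0 * slope v 0 0 +
      (slope v 0 1 * p 0 1 + p 0 1 * slope v 0 1) by rewrite dotE; ring.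
  by apply: eq_has_tderiv => s _; rewrite dotE.
have := has_tderiv_comp1 tT dd (is_derive1_sqrt pp).
rewrite -/(enorm p); have L0 : L != 0 by rewrite gt_eqF// (slope_norm_gt0 jJ a01 xC).
suff -> : p *d slope v / L = 2 * (p *d slope v) * (2 * L)^-1 by [].
by field.
Qed.

Lemma sqrt_g_axis (s : R) : s \in `]0, T] -> d0 q -> Num.sqrt (g (X s q)) = 0.
Proof.
move=> sT qd0; have [_ _ g0] := h0 (ex_intro _ q qd0).
by rewrite g0 ?sqrtr0//; case: (XC sT) => _ + _ _; exact.
Qed.

Section Regular.
Hypothesis qd0 : ~ d0 q.
Let xH : H (x q). Proof. exact: (quad_point_H jJ a01 xC). Qed.
Let S0 : S != 0. Proof. by rewrite gt_eqF// sqrtr_gt0 (g_gt0 hg). Qed.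

Lemma tderiv_sqrt_g : D (fun s => Num.sqrt (g (X s q))) (2^-1 * S * gl v).
Proof.
have gd := has_tderiv_comp tT (Xt q01) (g_differentiable hg xH).
have := has_tderiv_comp1 tT gd (is_derive1_sqrt (g_gt0 hg xH)).
rewrite derive_grad; last exact: (g_differentiable hg xH).
rewrite (grad_lng hg xH) dotC dotZr dotC -(glogE hg hI h0 jJ a01 xC v0 qd0).
have -> : g (x q) * gl v * (2 * S)^-1 = S ^+ 2 * gl v * (2 * S)^-1.
  by rewrite sqr_sqrtr// ltW// (g_gt0 hg).
suff -> : S ^+ 2 * gl v * (2 * S)^-1 = 2^-1 * S * gl v by [].
by field.
Qed.

(** Here [y] is kept fixed in time, so the chain rule produces the Hessian. *)
Lemma tderiv_glog : D (fun s => glog g J j a (X s) y) (hl y v).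
Proof.
have pd i : D (fun s => partial i lng (X s q)) (grad (partial i lng) (x q) *d v q).
  rewrite -derive_grad; last exact: (partial_lng_differentiable hg i xH).
  exact: (has_tderiv_comp tT (Xt q01) (partial_lng_differentiable hg i xH)).
have := has_tderivD (has_tderivM tT (pd 0) (has_tderiv_cst T (y q 0 0) t))
                    (has_tderivM tT (pd 1) (has_tderiv_cst T (y q 0 1) t)).
rewrite !mulr0 !addr0 -hess_dot -(hlogE hg hI h0 jJ a01 xC y0 v0 qd0).
apply: eq_has_tderiv => s sT; rewrite (glogE hg hI h0 jJ a01 (XC sT))//.
by rewrite dotE !mxE.
Qed.

End Regular.

(** The formula also holds on the axis, where both sides are zero because
    g^(1/2) vanishes there at all times. *)
Lemma tderiv_energy :
  D (fun s => energy_at g J (X s) (kap s) j a)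
    (2 * kq * kt q * (S * L) +
     kq ^+ 2 * (2^-1 * S * gl v * L + S * (p *d slope v / L))).
Proof.
have E s : s \in `]0, T] -> kap s q ^+ 2 * (Num.sqrt (g (X s q)) * enorm (slope (X s)))
    = energy_at g J (X s) (kap s) j a.
  by move=> sT; rewrite (energy_atE hg hI h0 jJ a01 (XC sT) (kV sT)).
apply: eq_has_tderiv E _.
have [qd0|qd0] := pselect (d0 q).
  have -> : S = 0 by exact: (sqrt_g_axis tT qd0).
  have -> : 2 * kq * kt q * (0 * L) +
     kq ^+ 2 * (2^-1 * 0 * gl v * L + 0 * (p *d slope v / L)) = 0 by ring.
  apply: eq_has_tderiv (has_tderiv_cst T (0 : R) t) => s sT.
  by rewrite (sqrt_g_axis sT qd0) mul0r mulr0.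
have kd := kapt q01.
have := has_tderivM tT (has_tderivM tT kd kd)
  (has_tderivM tT (tderiv_sqrt_g qd0) tderiv_norm).
set l := (X in D _ X); set l' := (X in _ -> D _ X).
have -> : l = l' by rewrite /l /l'; ring.
by apply: eq_has_tderiv => s _; rewrite expr2.
Qed.

Lemma tderiv_side :
  D (fun s => side_at g J (X s) (kap s) y j a)
    (S ^+ 2 * gl v * kq * cross p (y q) + S ^+ 2 * kt q * cross p (y q)
     + S ^+ 2 * kq * cross (slope v) (y q)
     + (2^-1 * S * gl v / L - S * (p *d slope v) / L ^+ 3) * (p *d slope y)
     + S / L * (slope v *d slope y)
     + 2^-1 * (hl y v * (S * L)
               + gl y * (2^-1 * S * gl v * L + S * (p *d slope v / L)))).
Proof.
have E s : s \in `]0, T] ->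
    Num.sqrt (g (X s q)) ^+ 2 * kap s q * cross (slope (X s)) (y q)
    + Num.sqrt (g (X s q)) / enorm (slope (X s)) * (slope (X s) *d slope y)
    + 2^-1 * (glog g J j a (X s) y *
              (Num.sqrt (g (X s q)) * enorm (slope (X s))))
    = side_at g J (X s) (kap s) y j a.
  by move=> sT; rewrite (side_atE hg hI h0 jJ a01 (XC sT) (kV sT)).
apply: eq_has_tderiv E _.
have [qd0|qd0] := pselect (d0 q).
  have -> : S = 0 by exact: (sqrt_g_axis tT qd0).
  set l := (X in D _ X); have -> : l = 0 by rewrite /l; ring.
  apply: eq_has_tderiv (has_tderiv_cst T (0 : R) t) => s sT.
  by rewrite (sqrt_g_axis sT qd0) expr2 !mul0r !mulr0 !addr0.
have L0 : L != 0 by rewrite gt_eqF// (slope_norm_gt0 jJ a01 xC).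
have kd := kapt q01; have sd := tderiv_sqrt_g qd0; have C i := tderiv_slope i.
have cd b : D (fun=> b : R) 0 by exact: has_tderiv_cst.
have crossd := has_tderivD (has_tderivM tT (C 0) (cd (y q 0 1)))
  (has_tderivM tT (cd (-1)) (has_tderivM tT (C 1) (cd (y q 0 0)))).
have dotd := has_tderivD (has_tderivM tT (C 0) (cd (slope y 0 0)))
  (has_tderivM tT (C 1) (cd (slope y 0 1))).
have invd := has_tderiv_comp1 tT tderiv_norm
  (@is_deriveV R id L 1 1 L0 (is_derive_id L 1)).
have := has_tderivD (has_tderivD
  (has_tderivM tT (has_tderivM tT (has_tderivM tT sd sd) kd) crossd)
  (has_tderivM tT (has_tderivM tT sd invd) dotd))
  (has_tderivM tT (cd 2^-1)
    (has_tderivM tT (tderiv_glog qd0) (has_tderivM tT sd tderiv_norm))).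
set l := (X in D _ X -> _); set l' := (X in _ -> D _ X).
have -> : l = l'.
  rewrite /l /l' /cross !dotE /GRing.scale/= mulr1; field.
  exact: L0.
by apply: eq_has_tderiv => s _; rewrite /cross !dotE; ring.
Qed.

(** The cancellation behind the energy law. With [s = g^(1/2)] and [L = |X_rho|],
    the energy density [kappa^2 s L / 2] changes by [kappa kappa_t s L] and by
    [kappa^2 (s L)_t / 2]. The summand of the curvature term that contains [y]
    cancels the part of the derivative of the side term that contains [kappa_t]
    and leaves the former; the rest of that derivative exceeds the motion term
    by the latter. *)
Lemma energy_identity : exists e d : R, [/\
  D (fun s => energy_at g J (X s) (kap s) j a) e,
  D (fun s => side_at g J (X s) (kap s) y j a) d
  & 2^-1 * e = curvature_at g J x (kap t) y kt j a + d
               - motion_at g J x (kap t) y v j a].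
Proof.
exists (2 * kq * kt q * (S * L) +
     kq ^+ 2 * (2^-1 * S * gl v * L + S * (p *d slope v / L))).
eexists; split; [exact: tderiv_energy|exact: tderiv_side|].
have L0 : L != 0 by rewrite gt_eqF// (slope_norm_gt0 jJ a01 xC).
have kVt := kV tT.
rewrite (curvature_atE hg hI h0 jJ a01 xC kVt ktV y0).
rewrite (motion_atE hg hI h0 jJ a01 xC kVt y0 v0).
field.
exact: L0.
Qed.

End Evolution.

(** * Time derivatives of finite element functions *)

Section TestFunctions.
Context {R : realType}.

Lemma piecewise_affine_continuous (J : nat) (f : R -> R) : (0 < J)%N ->
  (forall j, (j < J)%N -> exists a b : R,
     forall r, r \in `[node J j, node J j.+1] -> f r = a * r + b) ->
  {within `[0, 1], continuous f}.
Proof.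
move=> J0 fE.
have elem j : (j < J)%N -> {within `[node J j, node J j.+1], continuous f}.
  move=> jJ; have [a [b ab]] := fE j jJ.
  apply: (@subspace_eq_continuous _ _ _ (fun r : R => a * r + b)).
    by move=> r; rewrite inE => rI; apply/esym; exact: ab.
  apply: continuous_subspaceT => r; apply: cvgD; last exact: cvg_cst.
  by apply: cvgMr; exact: cvg_id.
have pre n : (n < J)%N -> {within `[node J 0, node J n.+1], continuous f}.
  elim: n => [|n IH] nJ; first exact: (elem 0 nJ).
  have l1 : node J 0 <= node J n.+1 :> R.
    by rewrite {1}/node mul0r; exact: node_ge0.
  have l2 := @node_lt R J n.+1 nJ.
  have -> : `[node J 0, node J n.+2]%classic =
      (`[node J 0, node J n.+1] `|` `[node J n.+1, node J n.+2] : set R)%classic.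
    apply/seteqP; split => r /=; rewrite !in_itv/=.
      by move=> /andP[r0 r1]; case: (leP r (node J n.+1)) => rn;
        [left|right]; rewrite ?r0 ?r1 ?(ltW rn).
    case=> /andP[r0 r1]; first by rewrite r0 (le_trans r1 (ltW l2)).
    by rewrite r1 (le_trans l1 r0).
  apply: withinU_continuous; [exact: itv_closed|exact: itv_closed| |exact: (elem _ nJ)].
  exact: (IH (ltnW nJ)).
have J1 : (J.-1 < J)%N by rewrite prednK.
have := pre _ J1; rewrite prednK//.
have -> : node J 0 = 0 :> R by rewrite /node mul0r.
by have -> : node J J = 1 :> R by rewrite /node mulfV// pnatr_eq0 -lt0n.
Qed.

(** On each element the nodal values determine [f s] by an affine formula with
    time-independent coefficients, which the time derivative inherits. *)
Lemma Vh_tderiv (I : param_domain) (J : nat) (T t : R) (f : R -> R -> R)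
    (df : R -> R) :
  (0 < J)%N -> t \in `]0, T] ->
  (forall s : R, s \in `]0, T] -> Vh I J (f s)) ->
  (forall r : R, r \in `[0, 1] -> has_tderiv T (fun s => f s r) t (df r)) ->
  Vh I J df.
Proof.
move=> J0 tT fV fd.
have aff j : (j < J)%N -> exists a b : R,
    forall r, r \in `[node J j, node J j.+1] -> df r = a * r + b.
  move=> jJ; exists (slope J j df), (df (node J j) - slope J j df * node J j) => r rI.
  have l : (node J j : R) \in `[node J j, node J j.+1].
    by rewrite in_itv/= lexx ltW// (@node_lt R J j jJ).
  have u : (node J j.+1 : R) \in `[node J j, node J j.+1].
    by rewrite in_itv/= lexx ltW// (@node_lt R J j jJ).
  have D z : z \in `[node J j, node J j.+1] -> has_tderiv T (fun s => f s z) t (df z).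
    by move=> zI; apply: fd; exact: (elem_in01 jJ).
  have cd b : has_tderiv T (fun=> b : R) t 0 by exact: has_tderiv_cst.
  have := has_tderivD (D _ l) (has_tderivM tT (cd (r - node J j))
    (has_tderivM tT (cd J%:R) (has_tderivD (D _ u) (has_tderivM tT (cd (-1)) (D _ l))))).
  set d := (X in has_tderiv _ _ _ X -> _) => h.
  have -> : df r = d.
    apply: (has_tderiv_unique tT (D _ rI)); apply: eq_has_tderiv h => s sT.
    by rewrite (Vh_affine jJ (fV s sT) l rI) /slope mulN1r.
  rewrite /d /slope /GRing.scale/=; ring.
split => //; first exact: (piecewise_affine_continuous J0).
case: I fV => // fV.
have d0 : has_tderiv T (fun s => f s 0) t (df 0).
  by apply: fd; rewrite in_itv/= lexx ler01.
apply: (has_tderiv_unique tT d0).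
have d1 : has_tderiv T (fun s => f s 1) t (df 1).
  by apply: fd; rewrite in_itv/= lexx ler01.
by apply: eq_has_tderiv d1 => s sT; case: (fV s sT).
Qed.

End TestFunctions.

Section Quadrature.
Context {R : realType} (J K : nat) (w : 'I_K -> R).

Definition qsum (f : 'I_J -> 'I_K -> R) : R :=
  J%:R^-1 * \sum_(j < J) \sum_(k < K) w k * f j k.

Lemma qsumD f f' : qsum (fun j k => f j k + f' j k) = qsum f + qsum f'.
Proof.
rewrite /qsum -mulrDr -big_split; congr (_ * _); apply: eq_bigr => j _.
by rewrite -big_split; apply: eq_bigr => k _; rewrite mulrDr.
Qed.

Lemma qsumZ c f : qsum (fun j k => c * f j k) = c * qsum f.
Proof.
rewrite /qsum mulrCA; congr (_ * _); rewrite mulr_sumr; apply: eq_bigr => j _.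
by rewrite mulr_sumr; apply: eq_bigr => k _; rewrite mulrCA.
Qed.

Lemma qsumN f : qsum (fun j k => - f j k) = - qsum f.
Proof.
rewrite -mulN1r -qsumZ; congr qsum; apply/funext => j; apply/funext => k.
by rewrite mulN1r.
Qed.

Lemma has_tderiv_qsum (T t : R) (f : R -> 'I_J -> 'I_K -> R) df :
  t \in `]0, T] ->
  (forall j k, has_tderiv T (fun s => f s j k) t (df j k)) ->
  has_tderiv T (fun s => qsum (f s)) t (qsum df).
Proof.
move=> tT fd.
have cd b : has_tderiv T (fun=> b : R) t 0 by exact: has_tderiv_cst.
have := has_tderivM tT (cd J%:R^-1) (has_tderiv_sum (fun j =>
  has_tderiv_sum (fun k => has_tderivM tT (cd (w k)) (fd j k)))).
rewrite mul0r add0r; under eq_bigr do under eq_bigr do rewrite mul0r add0r.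
exact.
Qed.

End Quadrature.

Lemma has_tderiv_sum_seq {R : realType} (T t : R) (P : eqType) (r : seq P)
    (f : P -> R -> R) :
  (forall p, p \in r -> has_tderiv T (f p) t 0) ->
  has_tderiv T (fun s => \sum_(p <- r) f p s) t 0.
Proof.
elim: r => [_|p r IH fd].
  by under eq_fun do rewrite big_nil; exact: has_tderiv_cst.
under eq_fun do rewrite big_cons.
have := has_tderivD (fd p (mem_head _ _)) (IH _); rewrite addr0; apply.
by move=> z zr; apply: fd; rewrite inE zr orbT.
Qed.

(** * The energy law *)

Section EnergyLaw.
Context {R : realType}.
Local Notation vec := 'rV[R]_2.
Variables (H : set vec) (g : vec -> R).
Hypothesis hg : metric H g.
Variables (I : param_domain) (d0 dC dN : set R).
Hypotheses (hI : boundary_partition I d0 dC dN)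
  (h0 : d0 !=set0 -> axis_metric H g).
Variables (zeta : R -> vec) (J K : nat) (w alpha : 'I_K -> R).
Hypotheses (hJ : (0 < J)%N) (hq : quadrature_rule w alpha).
Variables (T : R) (X : R -> R -> vec) (kap : R -> R -> R) (Y om : R -> R -> vec).
Hypothesis hsol : is_solution H g I d0 dC dN zeta J w alpha T X kap Y om.
Variable t : R.
Hypothesis tT : t \in `]0, T].
Local Notation v := (velocity T X t).

Lemma solution_admissible (s : R) :
  s \in `]0, T] -> admissible_curve H I d0 J (X s).
Proof.
move=> sT; have [xV _ _] := sol_spaces hsol sT; split => //.
- by move=> p; exact: (sol_axis hsol).
- by move=> r r01; exact: (sol_in_H hsol).
- by move=> j r; exact: (sol_regular hsol).
Qed.

Lemma boundary_in01 (p : R) : bdry I p -> p \in `[0, 1].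
Proof. by case: I => //= -[]->; rewrite in_itv/= ?lexx ?ler01. Qed.

(** Clamped endpoints have velocity zero and, not lying on the axis, stay where
    [g^(1/2)] is differentiable. *)
Lemma tderiv_clamped (eta : R -> vec) :
  has_tderiv T
    (fun s => \sum_(p \in dC) Num.sqrt (g (X s p)) * (zeta p *d eta p)) t 0.
Proof.
have dCb : dC `<=` bdry I by case: hI => <- _ _ _ p pC; left; right.
have fin : finite_set dC.
  apply: (sub_finite_set dCb); case: I => /=; first exact: finite_set0.
  by rewrite finite_setU; split; exact: finite_set1.
under eq_fun do rewrite fsbig_finite//.
apply: has_tderiv_sum_seq => p; rewrite in_fset_set// inE => pC.
have p01 : p \in `[0, 1] by apply: boundary_in01; exact: dCb.
have nd0 : ~ d0 p.
  by move=> p0; case: hI => _ /seteqP[+ _] _ _ => /(_ p); apply.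
have xH := sol_in_H hsol tT p01 nd0.
have [Xd _ _] := sol_derivable hsol tT p01.
have vp0 : v p = 0 by case: (sol_velocity hsol tT) => _; apply; left.
have gd := has_tderiv_comp tT (time_derivable_has tT Xd) (g_differentiable hg xH).
have sd := has_tderiv_comp1 tT gd (is_derive1_sqrt (g_gt0 hg xH)).
have := has_tderivM tT sd (has_tderiv_cst T (zeta p *d eta p) t).
by rewrite -/(velocity T X t p) vp0 derive0 !mul0r mulr0 addr0.
Qed.

Lemma energy_law :
  time_derivable T
    (fun s => ipq J w alpha (fun r => kap s r ^+ 2) (gspeed g (X s))) t
  /\ 2^-1 * time_derive T
       (fun s => ipq J w alpha (fun r => kap s r ^+ 2) (gspeed g (X s))) t
     + ipq J w alpha (fun r => g (X t r) * (v r *d om t r) ^+ 2)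
                     (gspeed g (X t)) = 0.
Proof.
have [_ _ _ al01 _] := hq.
have XC := solution_admissible.
have kV (s : R) : s \in `]0, T] -> Vh I J (kap s).
  by move=> sT; have [] := sol_spaces hsol sT.
have [_ _ yY] := sol_spaces hsol tT; have y0 : Vh2_0 I d0 J (Y t) by case: yY.
have vX := sol_velocity hsol tT; have v0 : Vh2_0 I d0 J v by case: vX.
pose kt r := time_derive T (fun s => kap s r) t.
have Xt (r : R) : r \in `[0, 1] -> has_tderiv T (fun s => X s r) t (v r).
  by move=> r01; have [? _ _] := sol_derivable hsol tT r01; exact: time_derivable_has.
have kapt (r : R) : r \in `[0, 1] -> has_tderiv T (fun s => kap s r) t (kt r).
  by move=> r01; have [_ ? _] := sol_derivable hsol tT r01; exact: time_derivable_has.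
have ktV : Vh I J kt by exact: (Vh_tderiv hJ tT kV kapt).
have [e eP] := choice (fun jk : 'I_J * 'I_K => energy_identity hg hI h0
  (ltn_ord jk.1) (al01 jk.2) tT XC kV Xt kapt v0 y0 ktV).
have [d dP] := choice eP.
have Ed : has_tderiv T
    (fun s => ipq J w alpha (fun r => kap s r ^+ 2) (gspeed g (X s))) t
    (qsum w (fun j k => e (j, k))).
  apply: (has_tderiv_qsum w
    (f := fun s (j : 'I_J) k => energy_at g J (X s) (kap s) j (alpha k)) tT) => j k.
  by have [] := dP (j, k).
have [dE ->] := has_tderiv_derivable tT Ed; split => //.
(* the side equation, differentiated with the test function Y t *)
have Sd : qsum w (fun j k => d (j, k)) = 0.
  have h : has_tderiv T
      (fun s => qsum w (fun (j : 'I_J) k =>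
                  side_at g J (X s) (kap s) (Y t) j (alpha k)))
      t (qsum w (fun j k => d (j, k))).
    apply: (has_tderiv_qsum w (f := fun s (j : 'I_J) k =>
      side_at g J (X s) (kap s) (Y t) j (alpha k)) tT) => j k.
    by have [] := dP (j, k).
  apply: (has_tderiv_unique tT h); apply: eq_has_tderiv (tderiv_clamped (Y t)).
  by move=> s sT; rewrite -(sol_side hsol sT yY) !qsumD qsumZ.
have M := sol_motion hsol tT vX.
have C := sol_curvature hsol tT ktV.
have -> : ipq J w alpha (fun r => g (X t r) * (v r *d om t r) ^+ 2) (gspeed g (X t))
    = ipq J w alpha (fun r => g (X t r) * (v r *d om t r))
        (fun r => v r *d om t r * gspeed g (X t) r).
  by congr quad; apply/funext => r; rewrite expr2 !mulrA.
have -> : ipq J w alpha (fun r => g (X t r) * (v r *d om t r))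
        (fun r => v r *d om t r * gspeed g (X t) r) =
    qsum w (fun (j : 'I_J) k => motion_at g J (X t) (kap t) (Y t) v j (alpha k)).
  move/eqP : M; rewrite subr_eq => /eqP ->.
  by rewrite /motion_at !qsumD qsumN !qsumZ mulNr addrC !addrA.
have Cq : qsum w (fun (j : 'I_J) k =>
    curvature_at g J (X t) (kap t) (Y t) kt j (alpha k)) = 0 by exact: C.
have -> : 2^-1 * qsum w (fun j k => e (j, k)) = qsum w (fun (j : 'I_J) k =>
    curvature_at g J (X t) (kap t) (Y t) kt j (alpha k) + d (j, k)
    - motion_at g J (X t) (kap t) (Y t) v j (alpha k)).
  rewrite -qsumZ; congr qsum; apply/funext => j; apply/funext => k.
  by have [_ _ ->] := dP (j, k).
by rewrite [X in X + _]qsumD qsumN [X in X - _ + _]qsumD Cq Sd !add0r addNr.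
Qed.

End EnergyLaw.

Unset Implicit Arguments.

Theorem theorem3p2 (R : realType)
  (H : set 'rV[R]_2) (g : 'rV[R]_2 -> R) (hg : metric H g)
  (I : param_domain) (d0 dC dN : set R) (hI : boundary_partition I d0 dC dN)
  (h0 : d0 !=set0 -> axis_metric H g)
  (zeta : R -> 'rV[R]_2) (hzeta : forall p, dC p -> enorm (zeta p) = 1)
  (J : nat) (hJ : (3 <= J)%N)
  (K : nat) (w alpha : 'I_K -> R) (hq : quadrature_rule w alpha)
  (T : R) (hT : 0 < T)
  (X : R -> R -> 'rV[R]_2) (kap : R -> R -> R) (Y om : R -> R -> 'rV[R]_2)
  (hsol : is_solution H g I d0 dC dN zeta J w alpha T X kap Y om) :
  forall t : R, t \in `]0, T] ->
    time_derivable T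
      (fun s => ipq J w alpha (fun r => kap s r ^+ 2) (gspeed g (X s))) t
    /\ 2^-1 * time_derive T
         (fun s => ipq J w alpha (fun r => kap s r ^+ 2) (gspeed g (X s))) t
       + ipq J w alpha (fun r => g (X t r) * (velocity T X t r *d om t r) ^+ 2)
                       (gspeed g (X t)) = 0.
Proof.
move=> t tT.
exact: (energy_law hg hI h0 (leq_trans (isT : (0 < 3)%N) hJ) hq hsol tT).
Qed.
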